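(* Let $m\in\mathbb N$, let $\alpha,\beta\in C^2(\mathbb R^{1+m};\mathbb R)$ and let $a^{jk}\in C^{1,2}(\mathbb R^{1+m};\mathbb R)$ satisfy $a^{jk}=a^{kj}$ $(j,k=1,\dots,m)$. Let $z,v\in C^2(\mathbb R^{1+m};\mathbb C)$ and $\Psi,\ell\in C^2(\mathbb R^{1+m};\mathbb R)$, and set $\theta=e^{\ell}$ and $v=\theta z$. Put $$\mathcal Pz=(\alpha+i\beta)z_t+\sum_{j,k=1}^m(a^{jk}z_j)_k,$$ $$A=\sum_{j,k=1}^m a^{jk}\ell_j\ell_k-\sum_{j,k=1}^m(a^{jk}\ell_j)_k-\Psi,\qquad I_1=i\beta v_t-\alpha\ell_tv+\sum_{j,k=1}^m(a^{jk}v_j)_k+Av,$$ $$M=\big[(\alpha^2+\beta^2)\ell_t-\alpha A\big]|v|^2+\alpha\sum_{j,k=1}^m a^{jk}v_j\overline v_k+i\beta\sum_{j,k=1}^m a^{jk}\ell_j(\overline v_kv-v_k\overline v),$$ $V=[V^1,\dots,V^m]$ with $$\begin{aligned}V^k=&\sum_{j=1}^m\Big\{-i\beta\big[a^{jk}\ell_j(\overline v_tv-\overline vv_t)+a^{jk}\ell_t(v_j\overline v-\overline v_jv)\big]-\alpha a^{jk}(v_j\overline v_t+\overline v_jv_t)\\&\qquad-\Psi a^{jk}(v_j\overline v+\overline v_jv)+a^{jk}(2A\ell_j+\Psi_j-2\alpha\ell_j\ell_t)|v|^2\Big\}\\&+\sum_{j,j',k'=1}^m\big(2a^{jk'}a^{j'k}-a^{jk}a^{j'k'}\big)\ell_j(v_{j'}\overline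 v_{k'}+\overline v_{j'}v_{k'}),\end{aligned}$$ and $$\begin{aligned}B=&(\alpha^2\ell_t)_t+(\beta^2\ell_t)_t-(\alpha A)_t-2\Big[\sum_{j,k=1}^m(\alpha a^{jk}\ell_j\ell_t)_k+\alpha\Psi\ell_t\Big]\\&+\sum_{j,k=1}^m(a^{jk}\Psi_k)_j+2\Big[\sum_{j,k=1}^m(a^{jk}\ell_jA)_k+A\Psi\Big].\end{aligned}$$ Then $$\begin{aligned}&\theta\big(\mathcal Pz\,\overline{I_1}+\overline{\mathcal Pz}\,I_1\big)+M_t+\operatorname{div}V\\&=2|I_1|^2+\sum_{j,k=1}^m\Big\{\sum_{j',k'=1}^m\big[2(a^{j'k}\ell_{j'})_{k'}a^{jk'}-(a^{jk}a^{j'k'}\ell_{j'})_{k'}\big]+\tfrac12(\alpha a^{jk})_t-a^{jk}\Psi\Big\}(v_k\overline v_j+\overline v_kv_j)\\&\quad+i\sum_{j,k=1}^m\big[(\beta a^{jk}\ell_j)_t+a^{jk}(\beta\ell_t)_j\big](\overline v_kv-v_k\overline v)-\sum_{j,k=1}^m a^{jk}\alpha_k(v_j\overline v_t+\overline v_jv_t)\\&\quad+i\Big[\beta\Psi+\sum_{j,k=1}^m(\beta a^{jk}\ell_j)_k\Big](\overline vv_t-v\overline v_t)+B|v|^2 .\end{aligned}$$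
   Context: Points of $\mathbb R^{1+m}$ are written $(t,x)=(t,x_1,\dots,x_m)$; a subscript $t$ denotes $\partial_t$ and a subscript $j,k,j',k'$ on a function (or on a parenthesized expression) denotes the partial derivative with respect to the corresponding coordinate $x_j,x_k,x_{j'},x_{k'}$. $\operatorname{div}V=\sum_{k=1}^m\partial_{x_k}V^k$. $C^{1,2}$ means $C^1$ in $t$ and $C^2$ in $x$. $i=\sqrt{-1}$ and an overline denotes complex conjugation. Derivatives of $A$ (which occur in $M_t$, $\operatorname{div}V$ and $B$) are understood in the sense of distributions where they do not exist classically. *)

(* Defs.v *)
From HB Require Import structures.
From mathcomp Require Import all_boot all_order all_algebra.
From mathcomp Require Import complex.
From mathcomp Require Import all_classical all_reals all_analysis.

Set Implicit Arguments.
Unset Strict Implicit.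
Unset Printing Implicit Defensive.

Import Order.TTheory GRing.Theory Num.Theory.
Import numFieldNormedType.Exports.

Local Open Scope classical_set_scope.
Local Open Scope ring_scope.

(* A point (t, x_1, ..., x_m) of R^{1+m} is a row vector p : 'rV[R]_m.+1 with
   t = p 0 ord0 and x_k = p 0 (lift ord0 k) for k : 'I_m.  Sums, products and
   scalings of functions are pointwise. *)

Definition partial (R : realType) (m : nat) (i : 'I_m.+1)
    (f : 'rV[R]_m.+1 -> R) : 'rV[R]_m.+1 -> R :=
  fun p => 'D_(delta_mx ord0 i) f p.

Definition dt (R : realType) (m : nat) (f : 'rV[R]_m.+1 -> R) :=
  partial ord0 f.

Definition dx (R : realType) (m : nat) (k : 'I_m) (f : 'rV[R]_m.+1 -> R) :=
  partial (lift ord0 k) f.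

(* R[i] carries no real normed structure in the library, so differentiation,
   regularity and integration of R[i]-valued functions are componentwise. *)

Definition cpartial (R : realType) (m : nat) (i : 'I_m.+1)
    (f : 'rV[R]_m.+1 -> R[i]) : 'rV[R]_m.+1 -> R[i] :=
  fun p => (partial i (@complex.Re R \o f) p
            +i* partial i (@complex.Im R \o f) p)%C.

Definition cdt (R : realType) (m : nat) (f : 'rV[R]_m.+1 -> R[i]) :=
  cpartial ord0 f.

Definition cdx (R : realType) (m : nat) (k : 'I_m)
    (f : 'rV[R]_m.+1 -> R[i]) :=
  cpartial (lift ord0 k) f.

Definition complexf (R : realType) (m : nat) (f : 'rV[R]_m.+1 -> R) :
    'rV[R]_m.+1 -> R[i] :=
  fun p => (f p)%:C%C.

Notation "f %:Cf" := (complexf f) (at level 1, left associativity,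
  format "f %:Cf").

Definition conjf (R : realType) (m : nat) (f : 'rV[R]_m.+1 -> R[i]) :
    'rV[R]_m.+1 -> R[i] :=
  fun p => conjc (f p).

Definition sqnormf (R : realType) (m : nat) (f : 'rV[R]_m.+1 -> R[i]) :
    'rV[R]_m.+1 -> R[i] :=
  fun p => `|f p| ^+ 2.

Definition partially_derivable (R : realType) (m : nat)
    (f : 'rV[R]_m.+1 -> R) (p : 'rV[R]_m.+1) (i : 'I_m.+1) : Prop :=
  derivable f p (delta_mx ord0 i).

Fixpoint Ck (R : realType) (m k : nat) (f : 'rV[R]_m.+1 -> R) : Prop :=
  if k is k'.+1 then
    [/\ continuous f,
        forall p i, partially_derivable f p i
      & forall i, Ck k' (partial i f)]
  else continuous f.

Definition cCk (R : realType) (m k : nat) (f : 'rV[R]_m.+1 -> R[i]) : Prop :=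
  Ck k (@complex.Re R \o f) /\ Ck k (@complex.Im R \o f).

(* C^1 in t and C^2 in x: the function and its derivatives f_t, f_j, f_{jk}
   exist and are jointly continuous; no mixed derivative f_{tj} is assumed. *)
Definition C12 (R : realType) (m : nat) (f : 'rV[R]_m.+1 -> R) : Prop :=
  [/\ continuous f,
      (forall p i, partially_derivable f p i) /\
        (forall i, continuous (partial i f)),
      forall (j k : 'I_m) p, partially_derivable (dx j f) p (lift ord0 k)
    & forall j k : 'I_m, continuous (dx k (dx j f))].

(* The integral over R^n as an iterated one-dimensional Lebesgue integral; it
   is only applied to continuous compactly supported functions. *)
Fixpoint iterated_integral (R : realType) (n : nat) :
    ('rV[R]_n -> R) -> R :=
  match n with
  | 0 => fun f => f 0
  | n'.+1 => fun f =>
      \int[@lebesgue_measure R]_(x in [set: R])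
        iterated_integral (fun y : 'rV[R]_n' =>
          f (row_mx (x%:M : 'rV[R]_1) y : 'rV[R]_(1 + n')))
  end.

Definition cintegral (R : realType) (m : nat) (f : 'rV[R]_m.+1 -> R[i]) : R[i] :=
  (iterated_integral (@complex.Re R \o f)
   +i* iterated_integral (@complex.Im R \o f))%C.

Definition test_function (R : realType) (m : nat)
    (phi : 'rV[R]_m.+1 -> R[i]) : Prop :=
  (forall k, cCk k phi) /\ compact (closure [set p | phi p != 0]).

(* Distributions are represented by their action phi |-> <T, phi>, a function
   ('rV[R]_m.+1 -> R[i]) -> R[i] with pointwise sums and scalings. Those used
   below are of order at most one, being sums of continuous functions and of
   first derivatives of continuous functions: they act on C^1_c, so that the
   product g T is defined by <g T, phi> = <T, g phi> for g of class C^1. *)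

Definition dist_of (R : realType) (m : nat) (f : 'rV[R]_m.+1 -> R[i]) :
    ('rV[R]_m.+1 -> R[i]) -> R[i] :=
  fun phi => cintegral (f * phi).

Definition dist_partial (R : realType) (m : nat) (i : 'I_m.+1)
    (T : ('rV[R]_m.+1 -> R[i]) -> R[i]) : ('rV[R]_m.+1 -> R[i]) -> R[i] :=
  fun phi => - T (cpartial i phi).

Definition dist_dt (R : realType) (m : nat)
    (T : ('rV[R]_m.+1 -> R[i]) -> R[i]) :=
  dist_partial ord0 T.

Definition dist_dx (R : realType) (m : nat) (k : 'I_m)
    (T : ('rV[R]_m.+1 -> R[i]) -> R[i]) :=
  dist_partial (lift ord0 k) T.

Definition dist_mul (R : realType) (m : nat) (g : 'rV[R]_m.+1 -> R[i])
    (T : ('rV[R]_m.+1 -> R[i]) -> R[i]) : ('rV[R]_m.+1 -> R[i]) -> R[i] :=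
  fun phi => T (g * phi).

Definition opP (R : realType) (m : nat) (alpha beta : 'rV[R]_m.+1 -> R)
    (a : 'I_m -> 'I_m -> 'rV[R]_m.+1 -> R) (z : 'rV[R]_m.+1 -> R[i]) :
    'rV[R]_m.+1 -> R[i] :=
  (alpha%:Cf + 'i%C *: beta%:Cf) * cdt z
  + \sum_(j < m) \sum_(k < m) cdx k ((a j k)%:Cf * cdx j z).

Definition fA (R : realType) (m : nat)
    (a : 'I_m -> 'I_m -> 'rV[R]_m.+1 -> R) (Psi l : 'rV[R]_m.+1 -> R) :
    'rV[R]_m.+1 -> R :=
  \sum_(j < m) \sum_(k < m) a j k * dx j l * dx k l
  - \sum_(j < m) \sum_(k < m) dx k (a j k * dx j l)
  - Psi.

Definition fI1 (R : realType) (m : nat) (alpha beta : 'rV[R]_m.+1 -> R)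
    (a : 'I_m -> 'I_m -> 'rV[R]_m.+1 -> R) (Psi l : 'rV[R]_m.+1 -> R)
    (v : 'rV[R]_m.+1 -> R[i]) : 'rV[R]_m.+1 -> R[i] :=
  'i%C *: (beta%:Cf * cdt v) - (alpha * dt l)%:Cf * v
  + \sum_(j < m) \sum_(k < m) cdx k ((a j k)%:Cf * cdx j v)
  + (fA a Psi l)%:Cf * v.

Definition fM (R : realType) (m : nat) (alpha beta : 'rV[R]_m.+1 -> R)
    (a : 'I_m -> 'I_m -> 'rV[R]_m.+1 -> R) (Psi l : 'rV[R]_m.+1 -> R)
    (v : 'rV[R]_m.+1 -> R[i]) : 'rV[R]_m.+1 -> R[i] :=
  ((alpha ^+ 2 + beta ^+ 2) * dt l - alpha * fA a Psi l)%:Cf * sqnormf v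
  + alpha%:Cf
    * (\sum_(j < m) \sum_(k < m) (a j k)%:Cf * cdx j v * cdx k (conjf v))
  + 'i%C *: (beta%:Cf
    * (\sum_(j < m) \sum_(k < m)
         (a j k * dx j l)%:Cf * (cdx k (conjf v) * v - cdx k v * conjf v))).

Definition fV (R : realType) (m : nat) (alpha beta : 'rV[R]_m.+1 -> R)
    (a : 'I_m -> 'I_m -> 'rV[R]_m.+1 -> R) (Psi l : 'rV[R]_m.+1 -> R)
    (v : 'rV[R]_m.+1 -> R[i]) (k : 'I_m) : 'rV[R]_m.+1 -> R[i] :=
  \sum_(j < m)
    (- ('i%C *: (beta%:Cf
         * ((a j k * dx j l)%:Cf * (cdt (conjf v) * v - conjf v * cdt v)
            + (a j k * dt l)%:Cf
              * (cdx j v * conjf v - cdx j (conjf v) * v))))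
     - (alpha * a j k)%:Cf
       * (cdx j v * cdt (conjf v) + cdx j (conjf v) * cdt v)
     - (Psi * a j k)%:Cf * (cdx j v * conjf v + cdx j (conjf v) * v)
     + (a j k * (2 *: (fA a Psi l * dx j l) + dx j Psi
                 - 2 *: (alpha * dx j l * dt l)))%:Cf * sqnormf v)
  + \sum_(j < m) \sum_(j' < m) \sum_(k' < m)
      ((2 *: (a j k' * a j' k) - a j k * a j' k') * dx j l)%:Cf
      * (cdx j' v * cdx k' (conjf v) + cdx j' (conjf v) * cdx k' v).

Definition fB (R : realType) (m : nat) (alpha beta : 'rV[R]_m.+1 -> R)
    (a : 'I_m -> 'I_m -> 'rV[R]_m.+1 -> R) (Psi l : 'rV[R]_m.+1 -> R) :
    'rV[R]_m.+1 -> R :=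
  dt (alpha ^+ 2 * dt l) + dt (beta ^+ 2 * dt l) - dt (alpha * fA a Psi l)
  - 2 *: (\sum_(j < m) \sum_(k < m) dx k (alpha * a j k * dx j l * dt l)
          + alpha * Psi * dt l)
  + \sum_(j < m) \sum_(k < m) dx j (a j k * dx k Psi)
  + 2 *: (\sum_(j < m) \sum_(k < m) dx k (a j k * dx j l * fA a Psi l)
          + fA a Psi l * Psi).

(* fB with the derivatives of the products containing A = fA a Psi l, which
   need not exist classically, taken in the sense of distributions. *)
Definition dist_B (R : realType) (m : nat) (alpha beta : 'rV[R]_m.+1 -> R)
    (a : 'I_m -> 'I_m -> 'rV[R]_m.+1 -> R) (Psi l : 'rV[R]_m.+1 -> R) :
    ('rV[R]_m.+1 -> R[i]) -> R[i] :=
  dist_of (dt (alpha ^+ 2 * dt l) + dt (beta ^+ 2 * dt l))%:Cf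
  - dist_dt (dist_of (alpha * fA a Psi l)%:Cf)
  - dist_of (2 *: (\sum_(j < m) \sum_(k < m)
                     dx k (alpha * a j k * dx j l * dt l)
                   + alpha * Psi * dt l))%:Cf
  + dist_of (\sum_(j < m) \sum_(k < m) dx j (a j k * dx k Psi))%:Cf
  + 2 *: (\sum_(j < m) \sum_(k < m)
            dist_dx k (dist_of (a j k * dx j l * fA a Psi l)%:Cf)
          + dist_of (fA a Psi l * Psi)%:Cf).

(* The right-hand side of the identity without its last term B |v|^2; it
   contains no derivative of A. *)
Definition rhs_without_B (R : realType) (m : nat)
    (alpha beta : 'rV[R]_m.+1 -> R)
    (a : 'I_m -> 'I_m -> 'rV[R]_m.+1 -> R) (Psi l : 'rV[R]_m.+1 -> R)
    (v : 'rV[R]_m.+1 -> R[i]) : 'rV[R]_m.+1 -> R[i] :=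
  2 *: sqnormf (fI1 alpha beta a Psi l v)
  + \sum_(j < m) \sum_(k < m)
      (\sum_(j' < m) \sum_(k' < m)
         (2 *: (dx k' (a j' k * dx j' l) * a j k')
          - dx k' (a j k * a j' k' * dx j' l))
       + 2^-1 *: dt (alpha * a j k) - a j k * Psi)%:Cf
      * (cdx k v * cdx j (conjf v) + cdx k (conjf v) * cdx j v)
  + 'i%C *: (\sum_(j < m) \sum_(k < m)
      (dt (beta * a j k * dx j l) + a j k * dx j (beta * dt l))%:Cf
      * (cdx k (conjf v) * v - cdx k v * conjf v))
  - \sum_(j < m) \sum_(k < m)
      (a j k * dx k alpha)%:Cf
      * (cdx j v * cdt (conjf v) + cdx j (conjf v) * cdt v)
  + 'i%C *: ((beta * Psi
              + \sum_(j < m) \sum_(k < m) dx k (beta * a j k * dx j l))%:Cf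
             * (conjf v * cdt v - v * cdt (conjf v))).

(* Main.v *)
(* Put w = conj v. Conjugating by theta turns theta P z into I1 + I2 with
   I2 = alpha v_t - i beta l_t v - 2 sum a^jk l_j v_k + Psi v, so that
   theta (P z conj I1 + conj (P z) I1) = 2 |I1|^2 + I1 conj I2 + conj I1 I2.
   Every product of a term of I1 with a term of conj I2 is a divergence plus
   lower order terms; the only second order ingredients are the symmetry of a
   and of the second derivatives of v. The terms where A multiplies a function
   are kept undifferentiated, which gives an identity valid everywhere for the
   C^1 parts M0, V0 of M, V (those not containing A). The classical identity
   follows by applying the product rule to the remaining parts
   - alpha A |v|^2 and 2 sum a^jk l_j A |v|^2 wherever A is differentiable.
   For the distributional identity, multiply by a test function: the integrals
   of the derivatives of M0 phi and V0 phi vanish, and the derivatives of A are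
   carried by |v|^2 phi. *)

Require Import Defs.
From HB Require Import structures.
From mathcomp Require Import all_boot all_order all_algebra.
From mathcomp Require Import complex.
From mathcomp Require Import all_classical all_reals all_analysis.
From mathcomp Require Import ring lra.
Set Implicit Arguments.
Unset Strict Implicit.
Unset Printing Implicit Defensive.
Import Order.TTheory GRing.Theory Num.Theory.
Import numFieldNormedType.Exports.
Local Open Scope classical_set_scope.
Local Open Scope ring_scope.

(** [A] contains the second derivatives of [l], so it is only continuous, and neither [fM] nor [fV]
    may be differentiated as a whole. At a fixed point the computation uses [A] only through its
    value, a mere number; this is why one pointwise identity serves both conclusions. For the
    distributional one, adding the exact derivatives of [M0 * phi] and [V0 k * phi] makes the two
    integrands equal as functions, so that linearity of the integral and the vanishing of the
    integral of a derivative suffice. Both facts are proved for iterated integrals by induction on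
    the dimension, driven by uniform continuity. In the algebra, summands on the two sides seldom
    agree term by term; double sums are compared after adding to each summand its transpose in [j]
    and [k]. The product of the second order part with the multiplier [sum a^jk l_j v_k] needs four
    indices and a cancellation of its own. *)

Lemma rV_norm_le (R : realType) n (p : 'rV[R]_n) (e : R) : 0 <= e ->
  (`|p| <= e) = [forall i, `|p ord0 i| <= e].
Proof.
move=> e0; rewrite {1}/Num.norm /= mx_normrE; apply/bigmax_leP/forallP => /=.
  by move=> [_ h] i; exact: (h (ord0, i)).
by move=> h; split=> // -[i j] _ /=; rewrite ord1.
Qed.

(** The order of [a] and [b] is left open, and [c] is located only by its distance to [a]: in the
    applications [a] is 0 and the increment may have either sign. *)
Lemma MVT_ball (R : realType) (f df : R -> R) (a b : R) :
  (forall x : R, is_derive x (1 : R) f (df x)) ->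
  exists2 c, `|c - a| <= `|b - a| & f b - f a = df c * (b - a).
Proof.
move=> fd.
have cf : continuous f.
  move=> x; apply: differentiable_continuous; apply/derivable1_diffP.
  by have [] := fd x.
have cw A : {within A, continuous f} by exact: continuous_subspaceT.
have [ab|/ltW ba] := leP a b.
  have [c] := MVT_segment ab (fun x _ => fd x) (cw _).
  rewrite in_itv/= => /andP[ac cb] E; exists c => //.
  by rewrite !ger0_norm ?subr_ge0// lerB.
have [c] := MVT_segment ba (fun x _ => fd x) (cw _).
rewrite in_itv/= => /andP[ac cb] E; exists c.
  by rewrite !ler0_norm ?subr_le0// lerN2 lerB.
by rewrite -opprB E; ring.
Qed.

(** Both difference quotients are the same function of [h], so a directional derivative becomes a
    one-variable derivative, to which the mean value theorem applies. *)
Lemma is_derive_line (R : realType) (V : normedModType R) (f : V -> R)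
    (p u : V) (s : R) : derivable f (p + s *: u) u ->
  is_derive s (1 : R) (fun s : R => f (p + s *: u)) ('D_u f (p + s *: u)).
Proof.
move=> df.
have E : (fun h : R => h^-1 *: (f (p + (h *: 1 + s) *: u) - f (p + s *: u))) =
         (fun h : R => h^-1 *: (f (h *: u + (p + s *: u)) - f (p + s *: u))).
  by apply/funext => h; rewrite scalerDl -scalerA scale1r addrCA.
apply: DeriveDef.
  by rewrite /derivable [X in X @ _]E.
by rewrite /derive [X in X @ _]E.
Qed.

(** The second difference is the increment between 0 and [s] of [g], the first difference of [f]
    along [w]. The mean value theorem in direction [u] brings out ['D_u f] at [c]; applied to
    ['D_u f] along [w], it then gives [d]. *)
Lemma second_difference_mean (R : realType) (V : normedModType R) (f : V -> R)
    (u w p : V) (s : R) :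
  (forall q, derivable f q u) -> (forall q, derivable ('D_u f) q w) ->
  exists c d, [/\ `|c| <= `|s|, `|d| <= `|s| &
    f (p + s *: u + s *: w) - f (p + s *: u) - f (p + s *: w) + f p =
    s ^+ 2 * 'D_w ('D_u f) (p + c *: u + d *: w)].
Proof.
move=> fu fuw.
pose g (x : R) := f (p + s *: w + x *: u) - f (p + x *: u).
have dg (x : R) : is_derive x (1 : R) g
    ('D_u f (p + s *: w + x *: u) - 'D_u f (p + x *: u)).
  by apply: is_deriveB; apply: is_derive_line.
have [c cs] := MVT_ball 0 s dg.
have dh (y : R) := @is_derive_line _ _ ('D_u f) (p + c *: u) w y (fuw _).
have [d ds] := MVT_ball 0 s dh.
rewrite !subr0 !scale0r !addr0 in cs ds * => Ed Ec.
exists c, d; split=> //.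
rewrite /g !scale0r !addr0 !(addrAC _ (s *: w)) Ed in Ec.
by rewrite expr2 -mulrA mulrC [s * _]mulrC -Ec; ring.
Qed.

(* Both mixed derivatives are limits of the same second difference quotient. *)
Lemma derive_swap (R : realType) (V : normedModType R) (f : V -> R) (u w p : V) :
  (forall q, derivable f q u) -> (forall q, derivable f q w) ->
  (forall q, derivable ('D_u f) q w) -> (forall q, derivable ('D_w f) q u) ->
  {for p, continuous ('D_w ('D_u f))} -> {for p, continuous ('D_u ('D_w f))} ->
  'D_w ('D_u f) p = 'D_u ('D_w f) p.
Proof.
move=> fu fw fuw fwu cuw cwu; apply/eqP; rewrite -subr_eq0 -normr_le0.
apply/ler_addgt0Pr => e e0; rewrite add0r.
have e20 : 0 < e / 2 by rewrite divr_gt0.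
move/cvgrPdist_lt : cuw => /(_ _ e20)/nbhs_ballP[d1 /= d10 h1].
move/cvgrPdist_lt : cwu => /(_ _ e20)/nbhs_ballP[d2 /= d20 h2].
pose d := Num.min d1 d2; have d0 : 0 < d by rewrite lt_min d10.
(* Points [p + a *: u + b *: w] with [|a|] and [|b|] at most [s] lie within [s * (|u| + |w|)] of
   [p], hence within [d]. The extra 1 makes the denominator positive and the inequality strict. *)
pose s := d / (`|u| + `|w| + 1).
have N0 : 0 < `|u| + `|w| + 1 by rewrite ltr_wpDl// addr_ge0.
have s0 : 0 < s by rewrite divr_gt0.
have near_p a b : `|a| <= `|s| -> `|b| <= `|s| -> ball p d (p + a *: u + b *: w).
  rewrite !(ger0_norm (ltW s0)) => ha hb.
  rewrite -ball_normE /ball_ /= -addrA opprD addNKr normrN.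
  apply: (le_lt_trans (ler_normD _ _)); rewrite !normrZ.
  apply: (@le_lt_trans _ _ (s * (`|u| + `|w|))).
    by rewrite mulrDr lerD// ler_wpM2r.
  by rewrite -[ltRHS](divfK (lt0r_neq0 N0)) -/s ltr_pM2l// ltrDl.
have [c [c' [hc hc' E1]]] := second_difference_mean p s fu fuw.
have [b [b' [hb hb' E2]]] := second_difference_mean p s fw fwu.
have E12 : f (p + s *: u + s *: w) - f (p + s *: u) - f (p + s *: w) + f p =
           f (p + s *: w + s *: u) - f (p + s *: w) - f (p + s *: u) + f p.
  by rewrite (addrAC p (s *: w)); congr (_ + f p); exact: addrAC.
(* The second difference is symmetric in [u] and [w]; dividing by [s ^+ 2] gives a value [q] taken
   by both mixed derivatives near [p]. *)
have [q Eq1 Eq2] : exists2 q, 'D_w ('D_u f) (p + c *: u + c' *: w) = q &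
    'D_u ('D_w f) (p + b *: w + b' *: u) = q.
  apply: (ex_intro2 _ _ _ erefl).
  apply: (mulfI (_ : s ^+ 2 != 0)); first by rewrite expf_neq0// gt_eqF.
  exact: etrans (esym E2) (etrans (esym E12) E1).
have k1 : `|'D_w ('D_u f) p - q| < e / 2.
  by rewrite -Eq1; apply/h1/(@le_ball _ _ p d)/near_p; rewrite ?ge_min ?lexx.
have k2 : `|q - 'D_u ('D_w f) p| < e / 2.
  rewrite distrC -Eq2 addrAC; apply/h2/(@le_ball _ _ p d)/near_p => //.
  by rewrite ge_min lexx orbT.
rewrite (splitr e); apply: ltW; apply: le_lt_trans (ler_distD q _ _) _.
exact: ltrD k1 k2.
Qed.

(** * Iterated integrals of continuous compactly supported functions *)

(** The norm is the sup norm, so [f] lives on the cube of half-side [L]. The radius is explicit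
    because slices inherit it unchanged and because it enters the sup bound of the integral. *)
Definition continuous_vanishing (R : realType) n (L : R) (f : 'rV[R]_n -> R) :=
  continuous f /\ forall p, L < `|p| -> f p = 0.

(** Heine-Cantor on the compact ball of radius [L + 1]. The margin 1 deals with its complement: a
    point within 1 of such a [p] still has norm above [L], so both values are 0. *)
Lemma continuous_vanishing_unif (R : realType) n (L : R) (f : 'rV[R]_n -> R) :
  continuous_vanishing L f ->
  forall e, 0 < e -> exists2 d, 0 < d &
    forall p q, `|p - q| < d -> `|f p - f q| < e.
Proof.
move=> [cf f0] e e0.
pose K := [set p : 'rV[R]_n | `|p| <= L + 1].
have cK : compact K.
  apply: bounded_closed_compact.
    exists (L + 1); split; first exact: num_real.
    by move=> x Lx p /= pL; rewrite (le_trans pL)// ltW.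
  rewrite (_ : K = (fun p : 'rV[R]_n => `|p|) @^-1` [set x | x <= L + 1])//.
  apply: preimage_closed => [p _|]; [exact: norm_continuous|exact: closed_le].
have e20 : 0 < e / 2 by rewrite divr_gt0.
(* Compactness in covering form, with a modulus tending to 0 from the right: half of the local
   radius is spent on moving the point, the other half on the modulus. *)
have /= := (compact_near_coveringP K).1 cK R 0^'+
  (fun d p => forall q, `|p - q| < d -> `|f p - f q| < e) _.
case.
  move=> p Kp.
  have /cvgrPdist_lt/(_ _ e20)/nbhs_normP[d /= d0 h] := cf p.
  exists (ball p (d / 2), [set x : R | x < d / 2]).
    split=> /=; first by apply: nbhsx_ballx; rewrite divr_gt0.
    by apply: nbhs_right_lt; rewrite divr_gt0.
  move=> [p' x] [/= pp' xd] q p'q.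
  rewrite (splitr e) (le_lt_trans (ler_distD (f p) _ _))// ltrD//.
    rewrite distrC; apply: h => /=.
    move: pp'; rewrite -ball_normE /= => /lt_trans; apply.
    by rewrite gtr_pMr// invf_lt1// ltr1n.
  apply: h => /=; rewrite (splitr d) (le_lt_trans (ler_distD p' _ _))// ltrD//.
    by move: pp'; rewrite -ball_normE.
  exact: lt_trans p'q xd.
move=> d /= d0 h.
(* The estimate [h] holds for every modulus strictly between 0 and [d], hence for [d / 2]. *)
exists (Num.min (d / 2) 1); first by rewrite lt_min divr_gt0//=.
move=> p q; rewrite lt_min => /andP[pd p1].
have [Lp|pL] := ltP (L + 1) `|p|.
  have Lq : L < `|q|.
    rewrite -(ltrD2r 1) (lt_le_trans Lp)//.
    by rewrite -(subrK q p) (le_trans (ler_normD _ _))// addrC lerD2l ltW.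
  by rewrite !f0 ?subrr ?normr0// (lt_trans _ Lp)// ltrDl.
by apply: (h (d / 2)); rewrite ?divr_gt0//= sub0r normrN gtr0_norm ?divr_gt0//
  gtr_pMr// invf_lt1// ltr1n.
Qed.

Section iterated_integral.
Variable R : realType.
Notation mu := (@lebesgue_measure R).

Lemma row_mx_norm n (x : R) (y : 'rV[R]_n) (e : R) : 0 <= e ->
  (`|row_mx (x%:M : 'rV[R]_1) y| <= e) = (`|x| <= e) && (`|y| <= e).
Proof.
move=> e0; rewrite !rV_norm_le//; apply/forallP/andP => [h|[hx /forallP hy] i].
  split; first by have := h (lshift n ord0); rewrite row_mxEl mxE eqxx mulr1n.
  by apply/forallP => i; have := h (rshift 1 i); rewrite row_mxEr.
case: (split_ordP i) => j ->; first by rewrite row_mxEl [j]ord1 mxE eqxx mulr1n.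
by rewrite row_mxEr.
Qed.

Lemma continuous_row_mxr n (x : R) :
  continuous (fun y : 'rV[R]_n => row_mx (x%:M : 'rV[R]_1) y).
Proof.
move=> y A /nbhs_ballP[e /= e0 eA]; apply/nbhs_ballP; exists e => //= y' yy'.
apply: eA; case: yy' => _ yy'; split=> // i j.
case: (split_ordP j) => k ->; first by rewrite !row_mxEl; exact: ballxx.
by rewrite !row_mxEr; exact: yy'.
Qed.

Lemma continuous_vanishing_slice n L (f : 'rV[R]_(1 + n) -> R) x :
  continuous_vanishing L f ->
  continuous_vanishing L (fun y : 'rV[R]_n => f (row_mx (x%:M : 'rV[R]_1) y)).
Proof.
move=> [cf f0]; split.
  by move=> y; apply: continuous_comp; [exact: continuous_row_mxr|exact: cf].
move=> y Ly; apply: f0; have [L0|L0] := leP 0 L; last exact: lt_le_trans L0 _.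
by move: Ly; rewrite !ltNge row_mx_norm// negb_and orbC => ->.
Qed.

Lemma continuous_vanishing_slice0 n L (f : 'rV[R]_(1 + n) -> R) x :
  continuous_vanishing L f -> L < `|x| ->
  (fun y : 'rV[R]_n => f (row_mx (x%:M : 'rV[R]_1) y)) = cst 0.
Proof.
move=> [cf f0] Lx; apply/funext => y; apply: f0.
have [L0|L0] := leP 0 L; last exact: lt_le_trans L0 _.
by move: Lx; rewrite !ltNge row_mx_norm// negb_and => ->.
Qed.

Lemma continuous_vanishingD n L (f g : 'rV[R]_n -> R) :
  continuous_vanishing L f -> continuous_vanishing L g -> continuous_vanishing L (f + g).
Proof.
move=> [cf f0] [cg g0]; split=> [p|p Lp]; first by apply: continuousD; [exact: cf|exact: cg].
by rewrite fctE f0// g0// addr0.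
Qed.

Lemma continuous_vanishingZ n L (c : R) (f : 'rV[R]_n -> R) :
  continuous_vanishing L f -> continuous_vanishing L (c *: f).
Proof.
move=> [cf f0]; split=> [p|p Lp].
  by apply: (@continuousM R _ (cst c) f); [exact: cst_continuous|exact: cf].
by rewrite fctE f0// scaler0.
Qed.

Lemma Rintegral_segment L (f : R -> R) : (forall x, L < `|x| -> f x = 0) ->
  (\int[mu]_(x in [set: R]) f x = \int[mu]_(x in `[- L, L]) f x)%R.
Proof.
move=> f0; rewrite [RHS]Rintegral_mkcond; apply: eq_Rintegral => x _.
rewrite patchE; case: ifPn => //; rewrite notin_setE /= in_itv /= -ler_norml.
by move=> /negP; rewrite -ltNge => /f0.
Qed.

Lemma continuous_integrable_segment L (f : R -> R) : continuous f ->
  mu.-integrable `[- L, L] (EFin \o f).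
Proof.
move=> cf; apply: continuous_compact_integrable; first exact: segment_compact.
exact: continuous_subspaceT.
Qed.

Lemma Rintegral_segment_le L C (f : R -> R) : 0 <= L -> continuous f ->
  (forall x, `|f x| <= C) -> `|\int[mu]_(x in `[- L, L]) f x|%R <= 2 * L * C.
Proof.
move=> L0 cf fC.
have If := @continuous_integrable_segment L _ cf.
apply: le_trans (le_normr_Rintegral _ If) _ => //.
apply: (@le_trans _ _ (\int[mu]_(x in `[- L, L]) C)%R).
  apply: le_Rintegral => //.
  - by apply: continuous_integrable_segment => x; apply: cvg_norm; exact: cf.
  - by apply: continuous_integrable_segment => x; exact: cst_continuous.
rewrite Rintegral_cst//= lebesgue_measure_itv/= lte_fin.
case: ifPn => [_|].
  by rewrite -EFinB /= opprK mulrC -mulr2n mulr_natl.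
(* Here [[- L, L]] is a single point of measure 0, and the bound is nonnegative because [C]
   dominates [|f 0|]. *)
by rewrite -leNgt => h /=; rewrite mulr0 !mulr_ge0// (le_trans _ (fC 0)).
Qed.

(* The outer integral is additive because the inner one is continuous in the
   outer variable, which in turn follows from linearity and the sup bound in
   one dimension less: hence a single induction for these three facts. *)
Section induction_step.
Variables (n : nat).
Notation I := (@iterated_integral R n).
Hypothesis integral_le : forall L C f, 0 <= L -> continuous_vanishing L f ->
  (forall p, `|f p| <= C) -> `|I f| <= (2 * L) ^+ n * C.
Hypothesis integral_lin : forall L c f g, 0 <= L ->
  continuous_vanishing L f -> continuous_vanishing L g ->
  I (c *: f + g) = c * I f + I g.

Let slice (f : 'rV[R]_(1 + n) -> R) x := 
  fun y : 'rV[R]_n => f (row_mx (x%:M : 'rV[R]_1) y).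

Let sub f g : forall L, 0 <= L -> continuous_vanishing L f -> continuous_vanishing L g -> 
  I (f - g) = I f - I g.
Proof.
move=> L L0 hf hg.
by rewrite -[f - g]addrC -scaleN1r (integral_lin (-1) L0 hg hf) mulN1r addrC.
Qed.

Lemma integral0_step : I (cst 0) = 0.
Proof.
have h : continuous_vanishing 0 (cst 0 : 'rV[R]_n -> R) by split=> // p; exact: cst_continuous.
have := integral_lin 1 (lexx 0) h h.
rewrite mul1r scale1r -[LHS]add0r.
rewrite (_ : cst 0 + cst 0 = cst 0 :> ('rV[R]_n -> R)).
  by move/addIr => <-.
by apply/funext => x; rewrite fctE addr0.
Qed.

Let row_mx_sub (x x' : R) (y : 'rV[R]_n) :
  `|row_mx (x%:M : 'rV[R]_1) y - row_mx (x'%:M : 'rV[R]_1) y| = `|x - x'|.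
Proof.
rewrite opp_row_mx add_row_mx subrr -raddfB /=.
apply: le_anti; rewrite row_mx_norm// normr0 lexx normr_ge0 /=.
by have := lexx `|row_mx (x - x')%:M (0 : 'rV[R]_n)|;
  rewrite {1}row_mx_norm// => /andP[].
Qed.

(** Uniform continuity makes the slices at nearby [x] uniformly close; the sup bound in dimension
    [n] turns this into closeness of their integrals. *)
Lemma iterated_integral_slice_continuous L (f : 'rV[R]_(1 + n) -> R) : 0 <= L ->
  continuous_vanishing L f -> continuous (fun x => I (slice f x)).
Proof.
move=> L0 hf x; apply/cvgrPdist_le => e e0.
(* The volume factor of the sup bound, increased by 1 so that it stays positive when [L] is 0. *)
pose N := (2 * L) ^+ n + 1.
have N0 : 0 < N by rewrite ltr_wpDl// exprn_ge0// mulr_ge0.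
have [d d0 hd] := continuous_vanishing_unif hf (divr_gt0 e0 N0).
near=> x'; rewrite -(@sub _ _ L)//; [|exact: continuous_vanishing_slice..].
apply: le_trans (integral_le (C := e / N) L0 _ _) _.
- apply: continuous_vanishingD; first exact: continuous_vanishing_slice.
  by rewrite -scaleN1r; apply: continuous_vanishingZ; exact: continuous_vanishing_slice.
- move=> y /=; rewrite !fctE ltW// hd// row_mx_sub.
  by near: x'; exact: cvgr_dist_lt.
by rewrite mulrCA ler_piMr ?(ltW e0)// ler_pdivrMr// mul1r lerDl.
Unshelve. all: by end_near. Qed.

Lemma slice_norm_ge L (f : 'rV[R]_(1 + n) -> R) : 0 <= L ->
  continuous_vanishing L f -> forall x, L < `|x| -> I (slice f x) = 0.
Proof.
move=> L0 hf x Lx.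
by rewrite /slice (continuous_vanishing_slice0 hf Lx) integral0_step.
Qed.

(** Brings the outer integral to a segment, on which continuous functions are integrable. *)
Lemma iterated_integralS L (f : 'rV[R]_(1 + n) -> R) : 0 <= L ->
  continuous_vanishing L f ->
  @iterated_integral R n.+1 f = (\int[mu]_(x in `[- L, L]) I (slice f x))%R.
Proof.
by move=> L0 hf; rewrite -Rintegral_segment//; exact: slice_norm_ge.
Qed.

Lemma iterated_integralS_le L C (f : 'rV[R]_(1 + n) -> R) : 0 <= L ->
  continuous_vanishing L f -> (forall p, `|f p| <= C) ->
  `|@iterated_integral R n.+1 f| <= (2 * L) ^+ n.+1 * C.
Proof.
move=> L0 hf fC; rewrite (iterated_integralS L0)// exprS -mulrA.
apply: Rintegral_segment_le => //; first exact: iterated_integral_slice_continuous L0 hf.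
move=> x; apply: integral_le => //; [exact: continuous_vanishing_slice|by move=> y; exact: fC].
Qed.

Lemma iterated_integralS_lin L c (f g : 'rV[R]_(1 + n) -> R) : 0 <= L ->
  continuous_vanishing L f -> continuous_vanishing L g ->
  @iterated_integral R n.+1 (c *: f + g) =
  c * @iterated_integral R n.+1 f + @iterated_integral R n.+1 g.
Proof.
move=> L0 hf hg.
have If h : continuous_vanishing L h ->
    mu.-integrable `[- L, L] (EFin \o (fun x => I (slice h x))).
  move=> hh; apply: continuous_integrable_segment.
  exact: iterated_integral_slice_continuous L0 hh.
rewrite !(iterated_integralS L0)//; last first.
  by apply: continuous_vanishingD => //; exact: continuous_vanishingZ.
rewrite -RintegralZl//; last exact: If.
rewrite -RintegralD//; last 2 first.
- apply: continuous_integrable_segment => x.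
  apply: (@continuousM R R (cst c) (fun x => I (slice f x))).
    exact: cst_continuous.
  exact: iterated_integral_slice_continuous L0 hf x.
- exact: If.
apply: eq_Rintegral => x _; rewrite -(integral_lin c L0)//;
  exact: continuous_vanishing_slice.
Qed.

End induction_step.

Lemma iterated_integral_le_lin n :
  (forall L C f, 0 <= L -> continuous_vanishing L f -> (forall p, `|f p| <= C) ->
     `|@iterated_integral R n f| <= (2 * L) ^+ n * C) /\
  (forall L c f g, 0 <= L -> continuous_vanishing L f -> continuous_vanishing L g ->
     @iterated_integral R n (c *: f + g) =
     c * @iterated_integral R n f + @iterated_integral R n g).
Proof.
elim: n => [|n [IHle IHlin]].
  by split=> [L C f _ _ fC|//] /=; rewrite expr0 mul1r.
split=> [L C f|L c f g].
  exact: iterated_integralS_le.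
exact: iterated_integralS_lin.
Qed.

Lemma iterated_integral_le n L C f : 0 <= L -> continuous_vanishing L f ->
  (forall p, `|f p| <= C) -> `|@iterated_integral R n f| <= (2 * L) ^+ n * C.
Proof. exact: (iterated_integral_le_lin n).1. Qed.

Lemma iterated_integral_lin n L c f g : 0 <= L -> continuous_vanishing L f ->
  continuous_vanishing L g -> @iterated_integral R n (c *: f + g) =
     c * @iterated_integral R n f + @iterated_integral R n g.
Proof. exact: (iterated_integral_le_lin n).2. Qed.

Lemma derive_slice n (f : 'rV[R]_(1 + n) -> R) (x : R) (k : 'I_n) (y : 'rV[R]_n) :
  let g := fun y : 'rV[R]_n => f (row_mx (x%:M : 'rV[R]_1) y) in
  let p := row_mx (x%:M : 'rV[R]_1) y in
  (derivable f p (delta_mx ord0 (rshift 1 k)) -> derivable g y (delta_mx ord0 k)) /\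
  'D_(delta_mx ord0 k) g y = 'D_(delta_mx ord0 (rshift 1 k)) f p.
Proof.
move=> g p.
have E : (fun h : R => h^-1 *: (g (h *: delta_mx ord0 k + y) - g y)) =
  (fun h : R => h^-1 *: (f (h *: delta_mx ord0 (rshift 1 k) + p) - f p)).
  apply/funext => h; rewrite /g; congr (_ *: (f _ - _)).
  apply/rowP => i; case: (split_ordP i) => j ->.
    rewrite row_mxEl [in RHS]mxE row_mxEl !mxE.
    by rewrite eq_lrshift andbF mulr0 add0r.
  by rewrite row_mxEr [in RHS]mxE row_mxEr !mxE eq_rshift.
split; first by move=> h; rewrite /derivable [X in X @ _]E.
by rewrite /derive [X in lim (X @ _) = _]E.
Qed.

Lemma row_mx_line n (x h : R) (y : 'rV[R]_n) :
  row_mx ((x + h)%:M : 'rV[R]_1) y =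
  row_mx (x%:M : 'rV[R]_1) y + h *: delta_mx ord0 (lshift n ord0).
Proof.
apply/rowP => i; case: (split_ordP i) => j ->.
  by rewrite [RHS]mxE !row_mxEl !mxE (ord1 j) !eqxx !mulr1n mulr1.
by rewrite [RHS]mxE !row_mxEr !mxE eq_rlshift andbF mulr0 addr0.
Qed.

Lemma iterated_integral0 n : @iterated_integral R n (cst 0) = 0.
Proof. by apply: integral0_step => L; exact: iterated_integral_lin. Qed.

Lemma continuous_vanishing0 n L : continuous_vanishing L (cst 0 : 'rV[R]_n -> R).
Proof. by split=> // p; exact: cst_continuous. Qed.

Lemma iterated_integralZ n L c f : 0 <= L -> continuous_vanishing L f ->
  @iterated_integral R n (c *: f) = c * @iterated_integral R n f.
Proof.
move=> L0 hf; have := iterated_integral_lin c L0 hf (continuous_vanishing0 n L).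
by rewrite iterated_integral0 -[cst 0]/(0 : _ -> R) !addr0.
Qed.

Lemma iterated_integralD n L f g : 0 <= L -> continuous_vanishing L f ->
  continuous_vanishing L g -> @iterated_integral R n (f + g) =
     @iterated_integral R n f + @iterated_integral R n g.
Proof.
move=> L0 hf hg; by have := iterated_integral_lin 1 L0 hf hg; rewrite scale1r mul1r.
Qed.

Lemma continuous_vanishingB n L (f g : 'rV[R]_n -> R) :
  continuous_vanishing L f -> continuous_vanishing L g -> continuous_vanishing L (f - g).
Proof.
move=> hf hg; rewrite -scaleN1r; apply: continuous_vanishingD => //.
exact: continuous_vanishingZ.
Qed.

Lemma iterated_integralB n L f g : 0 <= L -> continuous_vanishing L f ->
  continuous_vanishing L g -> @iterated_integral R n (f - g) =
     @iterated_integral R n f - @iterated_integral R n g.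
Proof.
move=> L0 hf hg; rewrite -scaleN1r (iterated_integralD L0) ?(iterated_integralZ _ L0)//.
  by rewrite mulN1r.
exact: continuous_vanishingZ.
Qed.

(** Differentiation under the integral sign: by the mean value theorem each difference quotient is a
    value of ['D_u f] at distance at most [|h|], and uniform continuity of ['D_u f] controls the
    error uniformly in [y], so that the sup bound applies. *)
Lemma is_derive_iterated_integral n L (f : 'rV[R]_(1 + n) -> R) (x : R) :
  let u := delta_mx ord0 (lshift n ord0) in 0 <= L ->
  continuous_vanishing L f -> (forall p, derivable f p u) -> continuous_vanishing L ('D_u f) ->
  is_derive x (1 : R)
    (fun x => @iterated_integral R n (fun y => f (row_mx (x%:M : 'rV[R]_1) y)))
    (@iterated_integral R n (fun y => 'D_u f (row_mx (x%:M : 'rV[R]_1) y))).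
Proof.
move=> u L0 hf df hdf.
set F := (fun x => _); set G := iterated_integral _.
have H : (fun h : R => h^-1 *: ((F \o shift x) (h *: (1 : R)) - F x)) @ 0^' --> G.
  apply/cvgrPdist_le => e e0.
  pose N := (2 * L) ^+ n + 1.
  have N0 : 0 < N by rewrite ltr_wpDl// exprn_ge0// mulr_ge0.
  have [d d0 hd] := continuous_vanishing_unif hdf (divr_gt0 e0 N0).
  near=> h.
  have h0 : h != 0 by near: h; exact: nbhs_dnbhs_neq.
  have hsmall : `|h| < d.
    near: h; apply: dnbhs0_lt => //.
  have c1 := continuous_vanishing_slice x hdf.
  have c2 := continuous_vanishingZ h^-1 (continuous_vanishingB
    (continuous_vanishing_slice (h *: 1 + x) hf) (continuous_vanishing_slice x hf)).
  rewrite /F /= -(iterated_integralB L0 (continuous_vanishing_slice _ hf)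
    (continuous_vanishing_slice _ hf)).
  rewrite -[_ *: iterated_integral _](iterated_integralZ _ L0); last first.
    by apply: continuous_vanishingB; exact: continuous_vanishing_slice.
  rewrite -(iterated_integralB L0 c1 c2).
  apply: le_trans (iterated_integral_le (C := e / N) L0 (continuous_vanishingB c1 c2) _) _.
  - move=> y /=; rewrite !fctE.
    have D s := @is_derive_line _ _ f (row_mx (x%:M : 'rV[R]_1) y) u s (df _).
    (* The point [c] depends on [y]; the sup bound asks only for a pointwise estimate of the
       integrand. *)
    have [c hc] := MVT_ball 0 h D.
    rewrite -!row_mx_line !subr0 !addr0 in hc *; rewrite [h *: 1]mulr1 (addrC h) => ->.
    rewrite [_ *: _]mulrC mulfK// ltW// hd// row_mx_line opprD addNKr normrN.
    rewrite (le_lt_trans _ hsmall)// normrZ (le_trans _ hc)// ler_piMr//.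
    rewrite rV_norm_le//; apply/forallP => k; rewrite mxE eqxx /=.
    by case: eqP; rewrite ?normr1// normr0.
  by rewrite mulrCA ler_piMr ?(ltW e0)// ler_pdivrMr// mul1r lerDl.
by apply: DeriveDef; [apply/cvg_ex; exists G|apply: cvg_lim].
Unshelve. all: by end_near. Qed.

(** For a later coordinate the inner integral is 0 for each [x], by induction. For the first one,
    the inner integral is the derivative of the integral of the slices, and the fundamental theorem
    of calculus leaves two boundary values, both 0. *)
Lemma iterated_integral_derive n L (f : 'rV[R]_n -> R) (i : 'I_n) : 0 <= L ->
  continuous_vanishing L f -> (forall p, derivable f p (delta_mx ord0 i)) ->
  continuous_vanishing L ('D_(delta_mx ord0 i) f) ->
  iterated_integral ('D_(delta_mx ord0 i) f) = 0.
Proof.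
elim: n f i => [f []//|n IH f i L0 hf df hdf].
move: f i hf df hdf; rewrite -[n.+1]/(1 + n)%N => f i hf df hdf.
move: df hdf; case: (split_ordP i) => j -> {i} df hdf; last first.
  rewrite (iterated_integralS (@iterated_integral_lin n) L0 hdf) (_ : (fun _ => _) = cst 0).
    by rewrite Rintegral_cst// mul0r.
  apply/funext => x.
  rewrite -[RHS](IH (fun y : 'rV[R]_n => f (row_mx (x%:M : 'rV[R]_1) y)) j)//.
  - by congr iterated_integral; apply/funext => y; rewrite (derive_slice _ _ _ _).2.
  - exact: continuous_vanishing_slice.
  - by move=> y; apply: (derive_slice _ _ _ _).1.
  - rewrite (_ : 'D_(delta_mx ord0 j) _ =
      fun y => 'D_(delta_mx ord0 (rshift 1 j)) f (row_mx (x%:M : 'rV[R]_1) y)).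
      exact: continuous_vanishing_slice hdf.
    by apply/funext => y; rewrite (derive_slice _ _ _ _).2.
rewrite (ord1 j) in df hdf *.
(* [f] is known to vanish only where the norm strictly exceeds [L], so the endpoints are moved out
   to [L + 1]; the interval is then nondegenerate as well. *)
have L10 : 0 <= L + 1 by rewrite addr_ge0.
have LL : L < L + 1 by rewrite ltrDl.
have hdf1 : continuous_vanishing (L + 1) ('D_(delta_mx ord0 (lshift n ord0)) f).
  by split; [exact: hdf.1|move=> p Lp; apply: hdf.2; exact: lt_trans Lp].
rewrite (iterated_integralS (@iterated_integral_lin n) L10 hdf1) /Rintegral.
pose F x := iterated_integral (fun y : 'rV[R]_n => f (row_mx (x%:M : 'rV[R]_1) y)).
have dF x := is_derive_iterated_integral x L0 hf df hdf.
have cF : continuous F.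
  move=> x; apply: differentiable_continuous; apply/derivable1_diffP.
  by have [] := dF x.
have F0 x : L < `|x| -> F x = 0.
  by move=> Lx; rewrite /F (continuous_vanishing_slice0 hf Lx) iterated_integral0.
rewrite (@continuous_FTC2 _ _ F).
- by rewrite -EFinB /= !F0 ?subrr// ?normrN ger0_norm.
- by rewrite -subr_gt0 opprK addr_gt0// ltr_wpDl.
- apply: continuous_subspaceT => x.
  exact: (iterated_integral_slice_continuous (@iterated_integral_le n)
    (@iterated_integral_lin n) L0 hdf).
- split=> [x _||]; first by have [] := dF x.
    by apply: cvg_at_right_filter; exact: cF.
  by apply: cvg_at_left_filter; exact: cF.
- by move=> x _; rewrite derive1E; have [] := dF x.
Qed.

End iterated_integral.

(** * Calculus of complex-valued functions *)

Section complex_calculus.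
Variables (R : realType) (m : nat).
Local Notation X := ('rV[R]_m.+1 -> R[i]).
Implicit Types (f g : X) (p : 'rV[R]_m.+1) (i : 'I_m.+1) (d e : R[i]).

(** [cpartial] is total and says nothing about existence. This relation records existence and value
    together, so that the rules for sums and products compose. *)
Definition is_cpartial i f p d :=
  is_derive p (delta_mx ord0 i : 'rV[R]_m.+1) (@complex.Re R \o f) (complex.Re d) /\
  is_derive p (delta_mx ord0 i : 'rV[R]_m.+1) (@complex.Im R \o f) (complex.Im d).

Lemma is_cpartial_val i f p d : is_cpartial i f p d -> cpartial i f p = d.
Proof.
move=> [h1 h2]; rewrite /cpartial /partial !derive_val.
by case: d {h1 h2}.
Qed.

Lemma is_cpartialD i f g p d e : is_cpartial i f p d -> is_cpartial i g p e ->
  is_cpartial i (f + g) p (d + e).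
Proof.
move=> [f1 f2] [g1 g2]; split.
  rewrite (_ : _ \o _ = (@complex.Re R \o f) + (@complex.Re R \o g)).
    by rewrite raddfD; exact: is_deriveD.
  by apply/funext => q; rewrite /= !fctE raddfD.
rewrite (_ : _ \o _ = (@complex.Im R \o f) + (@complex.Im R \o g)).
  by rewrite raddfD; exact: is_deriveD.
by apply/funext => q; rewrite /= !fctE raddfD.
Qed.

Lemma is_cpartialM i f g p d e : is_cpartial i f p d -> is_cpartial i g p e ->
  is_cpartial i (f * g) p (d * g p + f p * e).
Proof.
move=> [f1 f2] [g1 g2]; split.
  rewrite (_ : _ \o _ = (@complex.Re R \o f) * (@complex.Re R \o g)
                        - (@complex.Im R \o f) * (@complex.Im R \o g)).
    apply: (is_derive_eq (is_deriveB (is_deriveM f1 g1) (is_deriveM f2 g2))).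
    rewrite /GRing.scale /=.
    by case: d e (f p) (g p) {f1 f2 g1 g2} => [a b] [a' b'] [x y] [x' y'] /=; ring.
  by apply/funext => q; rewrite /= !fctE; case: (f q) (g q) => [a b] [a' b'].
rewrite (_ : _ \o _ = (@complex.Re R \o f) * (@complex.Im R \o g)
                      + (@complex.Im R \o f) * (@complex.Re R \o g)).
  apply: (is_derive_eq (is_deriveD (is_deriveM f1 g2) (is_deriveM f2 g1))).
  rewrite /GRing.scale /=.
  by case: d e (f p) (g p) {f1 f2 g1 g2} => [a b] [a' b'] [x y] [x' y'] /=; ring.
by apply/funext => q; rewrite /= !fctE; case: (f q) (g q) => [a b] [a' b'].
Qed.

Lemma is_cpartial_cst i p d : is_cpartial i (cst d) p 0.
Proof. by split; exact: is_derive_cst. Qed.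

Lemma is_cpartialZ i c f p d : is_cpartial i f p d -> is_cpartial i (c *: f) p (c * d).
Proof.
move=> fd; rewrite -[c * d]add0r -(mul0r (f p)).
exact: is_cpartialM (is_cpartial_cst i p c) fd.
Qed.

Lemma is_cpartialN i f p d : is_cpartial i f p d -> is_cpartial i (- f) p (- d).
Proof.
move=> /(is_cpartialZ (-1)); rewrite mulN1r.
by rewrite (_ : -1 *: f = - f)//; apply/funext => q; exact: mulN1r.
Qed.

Lemma is_cpartialB i f g p d e : is_cpartial i f p d -> is_cpartial i g p e ->
  is_cpartial i (f - g) p (d - e).
Proof. by move=> fd ge; apply: is_cpartialD => //; exact: is_cpartialN. Qed.

Lemma is_cpartial_sum i n (F : 'I_n -> X) p (D : 'I_n -> R[i]) :
  (forall j, is_cpartial i (F j) p (D j)) ->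
  is_cpartial i (\sum_j F j) p (\sum_j D j).
Proof.
move=> FD; elim/big_rec2 : _ => [|j f d _]; first exact: is_cpartial_cst.
exact: is_cpartialD.
Qed.

Lemma cpartial_complexf i (f : 'rV[R]_m.+1 -> R) : cpartial i f%:Cf = (partial i f)%:Cf.
Proof.
apply/funext => p; rewrite /cpartial /complexf.
by rewrite [X in (_ +i* X)%C](@derive_cst _ _ _ 0).
Qed.

Lemma is_cpartial_conjf i f p d : is_cpartial i f p d ->
  is_cpartial i (conjf f) p (conjc d).
Proof.
move=> [f1 f2]; split.
  rewrite (_ : _ \o _ = @complex.Re R \o f); first by case: d f1 f2.
  by apply/funext => q /=; rewrite /conjf; case: (f q).
rewrite (_ : _ \o _ = - (@complex.Im R \o f)).
  by rewrite (_ : complex.Im (conjc d) = - complex.Im d); [exact: is_deriveN|case: d f1 f2].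
by apply/funext => q /=; rewrite /conjf !fctE /=; case: (f q).
Qed.

Definition continuousC f := continuous (@complex.Re R \o f) /\ continuous (@complex.Im R \o f).

Lemma continuousCD f g : continuousC f -> continuousC g -> continuousC (f + g).
Proof.
move=> [f1 f2] [g1 g2]; split=> p.
  rewrite (_ : _ \o _ = (@complex.Re R \o f) + (@complex.Re R \o g)).
    by apply: continuousD; [exact: f1|exact: g1].
  by apply/funext => q; rewrite /= !fctE raddfD.
rewrite (_ : _ \o _ = (@complex.Im R \o f) + (@complex.Im R \o g)).
  by apply: continuousD; [exact: f2|exact: g2].
by apply/funext => q; rewrite /= !fctE raddfD.
Qed.

Lemma continuousCM f g : continuousC f -> continuousC g -> continuousC (f * g).
Proof.
move=> [f1 f2] [g1 g2]; split=> p.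
  rewrite (_ : _ \o _ = (@complex.Re R \o f) * (@complex.Re R \o g)
                        - (@complex.Im R \o f) * (@complex.Im R \o g)).
    apply: continuousB; apply: continuousM;
      [exact: f1|exact: g1|exact: f2|exact: g2].
  by apply/funext => q; rewrite /= !fctE; case: (f q) (g q) => [a b] [a' b'].
rewrite (_ : _ \o _ = (@complex.Re R \o f) * (@complex.Im R \o g)
                      + (@complex.Im R \o f) * (@complex.Re R \o g)).
  apply: continuousD; apply: continuousM;
    [exact: f1|exact: g2|exact: f2|exact: g1].
by apply/funext => q; rewrite /= !fctE; case: (f q) (g q) => [a b] [a' b'].
Qed.

Lemma continuousC_cst d : continuousC (cst d).
Proof. by split=> p; exact: cst_continuous. Qed.

Lemma continuousCZ c f : continuousC f -> continuousC (c *: f).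
Proof. exact: continuousCM (continuousC_cst c). Qed.

Lemma scaleN1_fct f : -1 *: f = - f.
Proof. by apply/funext => q; exact: mulN1r. Qed.

Lemma continuousCN f : continuousC f -> continuousC (- f).
Proof. by move=> /(continuousCZ (-1)); rewrite scaleN1_fct. Qed.

Lemma continuousCB f g : continuousC f -> continuousC g -> continuousC (f - g).
Proof. by move=> fd ge; apply: continuousCD => //; exact: continuousCN. Qed.

Lemma continuousC_sum n (F : 'I_n -> X) :
  (forall j, continuousC (F j)) -> continuousC (\sum_j F j).
Proof.
move=> FD; elim/big_rec : _ => [|j f _]; first exact: continuousC_cst.
exact: continuousCD.
Qed.

Lemma continuousC_conjf f : continuousC f -> continuousC (conjf f).
Proof.
move=> [f1 f2]; split.
  rewrite (_ : _ \o _ = @complex.Re R \o f)//.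
  by apply/funext => q /=; rewrite /conjf; case: (f q).
rewrite (_ : _ \o _ = - (@complex.Im R \o f)).
  by move=> p; apply: continuousN; exact: f2.
by apply/funext => q /=; rewrite /conjf !fctE /=; case: (f q).
Qed.

(** A form of [cCk 1] stated through [is_cpartial], from which closure under the operations follows
    directly. *)
Definition C1C f := [/\ continuousC f, forall i p, is_cpartial i f p (cpartial i f p)
  & forall i, continuousC (cpartial i f)].

Lemma C1CE f : C1C f <-> cCk 1 f.
Proof.
split=> [[[f1 f2] fd cf]|[[c1 d1 e1] [c2 d2 e2]]].
  split; split=> //.
  - by move=> p i; have [[]] := fd i p.
  - by move=> i; have [] := cf i.
  - by move=> p i; have [_ []] := fd i p.
  - by move=> i; have [] := cf i.
split=> // [i p|i]; last by split; [exact: e1|exact: e2].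
by split; apply: DeriveDef => //; [exact: d1|exact: d2].
Qed.

Lemma C1C_intro f (D : 'I_m.+1 -> X) : continuousC f ->
  (forall i p, is_cpartial i f p (D i p)) -> (forall i, continuousC (D i)) -> C1C f.
Proof.
move=> cf fd cd; have E i : cpartial i f = D i.
  by apply/funext => p; exact: is_cpartial_val.
by split=> // [i p|i]; rewrite E.
Qed.

Lemma C1CD f g : C1C f -> C1C g -> C1C (f + g).
Proof.
move=> [f1 f2 f3] [g1 g2 g3].
apply: (@C1C_intro _ (fun i => cpartial i f + cpartial i g)).
- exact: continuousCD.
- by move=> i p; exact: is_cpartialD.
- by move=> i; exact: continuousCD.
Qed.

Lemma C1CM f g : C1C f -> C1C g -> C1C (f * g).
Proof.
move=> [f1 f2 f3] [g1 g2 g3].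
apply: (@C1C_intro _ (fun i => cpartial i f * g + f * cpartial i g)).
- exact: continuousCM.
- by move=> i p; exact: is_cpartialM.
- by move=> i; apply: continuousCD; exact: continuousCM.
Qed.

Lemma C1C_cst d : C1C (cst d).
Proof.
apply: (@C1C_intro _ (fun i => cst 0)).
- exact: continuousC_cst.
- by move=> i p; exact: is_cpartial_cst.
- by move=> i; exact: continuousC_cst.
Qed.

Lemma C1CZ c f : C1C f -> C1C (c *: f).
Proof. exact: C1CM (C1C_cst c). Qed.

Lemma C1CN f : C1C f -> C1C (- f).
Proof. by move=> /(C1CZ (-1)); rewrite scaleN1_fct. Qed.

Lemma C1C_sum n (F : 'I_n -> X) :
  (forall j, C1C (F j)) -> C1C (\sum_j F j).
Proof.
move=> FD; elim/big_rec : _ => [|j f _]; first exact: C1C_cst.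
exact: C1CD.
Qed.

Lemma C1C_conjf f : C1C f -> C1C (conjf f).
Proof.
move=> [f1 f2 f3]; apply: (@C1C_intro _ (fun i => conjf (cpartial i f))).
- exact: continuousC_conjf.
- by move=> i p; exact: is_cpartial_conjf.
- by move=> i; exact: continuousC_conjf.
Qed.

Lemma C1C_complexf (f : 'rV[R]_m.+1 -> R) : Ck 1 f -> C1C f%:Cf.
Proof.
move=> [cf df ddf]; apply/C1CE; split; first by [].
split; first exact: cst_continuous.
  by move=> p i; exact: derivable_cst.
by move=> i; rewrite (_ : partial i _ = cst 0);
  [exact: cst_continuous|apply/funext => p; exact: derive_cst].
Qed.

Lemma cpartial_conjf i f : C1C f -> cpartial i (conjf f) = conjf (cpartial i f).
Proof.
by move=> [_ fd _]; apply/funext => p; apply/is_cpartial_val/is_cpartial_conjf.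
Qed.

Lemma cpartialM i f g : C1C f -> C1C g ->
  cpartial i (f * g) = cpartial i f * g + f * cpartial i g.
Proof.
by move=> [_ fd _] [_ gd _]; apply/funext => p; apply/is_cpartial_val/is_cpartialM.
Qed.

Definition ccontinuous L f := continuousC f /\ forall p, L < `|p| -> f p = 0.

Lemma ccontinuousE L f : ccontinuous L f <->
  continuous_vanishing L (@complex.Re R \o f) /\ continuous_vanishing L (@complex.Im R \o f).
Proof.
split=> [[[f1 f2] f0]|[[f1 f10] [f2 f20]]].
  by split; split=> // p /f0 /= ->.
split=> // p Lp; have := f10 p Lp; have := f20 p Lp; rewrite /=.
by case: (f p) => a b /= -> ->.
Qed.

Lemma ccontinuousD L f g : ccontinuous L f -> ccontinuous L g -> ccontinuous L (f + g).
Proof.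
move=> [f1 f2] [g1 g2]; split; first exact: continuousCD.
by move=> p Lp; rewrite fctE f2// g2// addr0.
Qed.

Lemma ccontinuousMl L f g : continuousC f -> ccontinuous L g -> ccontinuous L (f * g).
Proof.
move=> f1 [g1 g2]; split; first exact: continuousCM.
by move=> p Lp; rewrite fctE g2// mulr0.
Qed.

Lemma ccontinuousZ L c f : ccontinuous L f -> ccontinuous L (c *: f).
Proof. exact: ccontinuousMl (continuousC_cst c). Qed.

Lemma ccontinuousN L f : ccontinuous L f -> ccontinuous L (- f).
Proof. by move=> /(ccontinuousZ (-1)); rewrite scaleN1_fct. Qed.

Lemma ccontinuous_sum L n (F : 'I_n -> X) :
  (forall j, ccontinuous L (F j)) -> ccontinuous L (\sum_j F j).
Proof.
move=> FD; elim/big_rec : _ => [|j f _]; first by split=> //; exact: continuousC_cst.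
exact: ccontinuousD.
Qed.

Lemma cintegralD L f g : 0 <= L -> ccontinuous L f -> ccontinuous L g ->
  cintegral (f + g) = cintegral f + cintegral g.
Proof.
move=> L0 /ccontinuousE[f1 f2] /ccontinuousE[g1 g2].
rewrite /cintegral.
rewrite (_ : _ \o (f + g) = (@complex.Re R \o f) + (@complex.Re R \o g)); last first.
  by apply/funext => q; rewrite /= !fctE raddfD.
rewrite (_ : _ \o (f + g) = (@complex.Im R \o f) + (@complex.Im R \o g)); last first.
  by apply/funext => q; rewrite /= !fctE raddfD.
by rewrite !(iterated_integralD L0).
Qed.

Lemma cintegralZ L c f : 0 <= L -> ccontinuous L f ->
  cintegral (c *: f) = c * cintegral f.
Proof.
move=> L0 /ccontinuousE[f1 f2]; case: c => a b; rewrite /cintegral.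
rewrite (_ : _ \o _ = a *: (@complex.Re R \o f) + (- b) *: (@complex.Im R \o f)); last first.
  by apply/funext => q; rewrite /= !fctE /=; case: (f q) => x y; rewrite /GRing.scale /= mulNr.
rewrite (_ : _ \o ((a +i* b)%C *: f) =
  a *: (@complex.Im R \o f) + b *: (@complex.Re R \o f)); last first.
  by apply/funext => q; rewrite /= !fctE /=; case: (f q) => x y /=.
rewrite !(iterated_integralD L0) ?(iterated_integralZ _ L0)//;
  try exact: continuous_vanishingZ.
by rewrite (mulNr b) [RHS]/GRing.mul.
Qed.

Lemma cintegral0 : cintegral (cst 0 : X) = 0.
Proof.
by rewrite /cintegral (_ : _ \o _ = cst 0)// (_ : _ \o _ = cst 0)// iterated_integral0.
Qed.

Lemma cintegralN L f : 0 <= L -> ccontinuous L f -> cintegral (- f) = - cintegral f.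
Proof. by move=> L0 hf; rewrite -scaleN1_fct (cintegralZ _ L0)// mulN1r. Qed.

Lemma cintegral_sum L n (F : 'I_n -> X) : 0 <= L -> (forall j, ccontinuous L (F j)) ->
  cintegral (\sum_j F j) = \sum_j cintegral (F j).
Proof.
move=> L0; elim: n F => [|n IH] F hF; first by rewrite !big_ord0 cintegral0.
rewrite !big_ord_recr /= (cintegralD L0)// ?IH//.
by apply: ccontinuous_sum => j; exact: hF.
Qed.

(** Having norm above [L] is an open condition, so [f] is 0 near such a point and is differentiated
    there as a constant. *)
Lemma cpartial_ccontinuous L i f : C1C f -> (forall p, L < `|p| -> f p = 0) ->
  ccontinuous L (cpartial i f).
Proof.
move=> [cf fd cdf] f0; split => // p Lp.
have near0 : \forall q \near p, f q = 0.
  near=> q; apply: f0; near: q.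
  have /cvgr_gt : `|q| @[q --> p] --> `|p| by exact: norm_continuous.
  exact.
apply: is_cpartial_val; split.
  apply: near_eq_is_derive (is_derive_cst (0 : R) p _).
  by apply: filterS near0 => q /= ->.
apply: near_eq_is_derive (is_derive_cst (0 : R) p _).
by apply: filterS near0 => q /= ->.
Unshelve. all: by end_near. Qed.

Lemma cintegral_cpartial L i f : 0 <= L -> C1C f -> (forall p, L < `|p| -> f p = 0) ->
  cintegral (cpartial i f) = 0.
Proof.
move=> L0 hf f0; have /ccontinuousE[h1 h2] := cpartial_ccontinuous i hf f0.
have [cf fd _] := hf.
have /ccontinuousE[c1 c2] : ccontinuous L f by [].
rewrite /cintegral (@iterated_integral_derive _ _ L (@complex.Re R \o f))//; last first.
  by move=> p; have [[]] := fd i p.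
rewrite (@iterated_integral_derive _ _ L (@complex.Im R \o f))//.
by move=> p; have [_ []] := fd i p.
Qed.

End complex_calculus.

(** * The algebraic identity *)

Section double_sums.
Variables (K : numFieldType) (m : nat).
Implicit Types F G : 'I_m -> 'I_m -> K.

(** Named so that double sums can be merged by rewriting and then abstracted as single atoms for
    [ring]. *)
Definition sum2 F := \sum_(j < m) \sum_(k < m) F j k.

Lemma sum2E F : \sum_(j < m) \sum_(k < m) F j k = sum2 F. Proof. by []. Qed.

Lemma sum2Z c F : c * sum2 F = sum2 (fun j k => c * F j k).
Proof. by rewrite /sum2 mulr_sumr; apply: eq_bigr => j _; rewrite mulr_sumr. Qed.

Lemma sum2Zr c F : sum2 F * c = sum2 (fun j k => F j k * c).
Proof. by rewrite /sum2 mulr_suml; apply: eq_bigr => j _; rewrite mulr_suml. Qed.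

Lemma sum2N F : - sum2 F = sum2 (fun j k => - F j k).
Proof. by rewrite /sum2 -sumrN; apply: eq_bigr => j _; rewrite sumrN. Qed.

Lemma sum2D F G : sum2 F + sum2 G = sum2 (fun j k => F j k + G j k).
Proof. by rewrite /sum2 -big_split; apply: eq_bigr => j _; rewrite -big_split. Qed.

Lemma eq_sum2 F G : (forall j k, F j k = G j k) -> sum2 F = sum2 G.
Proof. by move=> FG; apply: eq_bigr => j _; apply: eq_bigr => k _. Qed.

(** Exchanging the indices shows that twice a double sum is the sum of its symmetrized terms. The
    symmetry of [a] and of second derivatives can then be used inside the summand. *)
Lemma eq_sum2_sym F G : (forall j k, F j k + F k j = G j k + G k j) ->
  sum2 F = sum2 G.
Proof.
move=> FG; apply: (@mulfI _ (2 : K)); first by rewrite pnatr_eq0.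
have E H : 2 * sum2 H = sum2 (fun j k => H j k + H k j).
  by rewrite -sum2D mulrDl mul1r; congr (_ + _); rewrite {1}/sum2 exchange_big.
by rewrite !E; exact: eq_sum2.
Qed.

Definition sum4 (F : 'I_m -> 'I_m -> 'I_m -> 'I_m -> K) :=
  sum2 (fun k j => sum2 (fun j' k' => F k j j' k')).

Lemma sum4D (F G : 'I_m -> 'I_m -> 'I_m -> 'I_m -> K) :
  sum4 F + sum4 G = sum4 (fun k j j' k' => F k j j' k' + G k j j' k').
Proof. by rewrite /sum4 sum2D; apply: eq_sum2 => k j; rewrite sum2D. Qed.

Lemma sum4N (F : 'I_m -> 'I_m -> 'I_m -> 'I_m -> K) :
  - sum4 F = sum4 (fun k j j' k' => - F k j j' k').
Proof. by rewrite /sum4 sum2N; apply: eq_sum2 => k j; rewrite sum2N. Qed.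

Lemma sum4Z c (F : 'I_m -> 'I_m -> 'I_m -> 'I_m -> K) :
  c * sum4 F = sum4 (fun k j j' k' => c * F k j j' k').
Proof. by rewrite /sum4 sum2Z; apply: eq_sum2 => k j; rewrite sum2Z. Qed.

Lemma eq_sum4 (F G : 'I_m -> 'I_m -> 'I_m -> 'I_m -> K) :
  (forall k j j' k', F k j j' k' = G k j j' k') -> sum4 F = sum4 G.
Proof. by move=> FG; apply: eq_sum2 => k j; apply: eq_sum2 => j' k'. Qed.

Lemma sum4_swap_inner (F : 'I_m -> 'I_m -> 'I_m -> 'I_m -> K) :
  sum4 F = sum4 (fun k j j' k' => F k j k' j').
Proof. by apply: eq_sum2 => k j; rewrite {1}/sum2 exchange_big. Qed.

Lemma sum4_swap_outer (F : 'I_m -> 'I_m -> 'I_m -> 'I_m -> K) :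
  sum4 F = sum4 (fun k j j' k' => F j k j' k').
Proof. by rewrite {1}/sum4 {1}/sum2 exchange_big. Qed.

Lemma sum4_swap_mid (F : 'I_m -> 'I_m -> 'I_m -> 'I_m -> K) :
  sum4 F = sum4 (fun k j j' k' => F k j' j k').
Proof.
by apply: eq_bigr => k _; rewrite /sum2 exchange_big.
Qed.

Lemma sum2M F G : sum2 F * sum2 G = sum4 (fun k j j' k' => F k j * G j' k').
Proof. by rewrite sum2Zr; apply: eq_sum2 => k j; rewrite sum2Z. Qed.

(** The transposition of the first and last index, written as five exchanges of neighbours. *)
Lemma sum4_swap_ends (F : 'I_m -> 'I_m -> 'I_m -> 'I_m -> K) :
  sum4 F = sum4 (fun k j j' k' => F k' j j' k).
Proof.
rewrite sum4_swap_outer sum4_swap_mid sum4_swap_inner sum4_swap_mid.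
by rewrite sum4_swap_outer.
Qed.

Lemma sum4_exchange (F : 'I_m -> 'I_m -> 'I_m -> 'I_m -> K) :
  sum4 F = sum4 (fun k j j' k' => F j' k' j k).
Proof.
rewrite sum4_swap_mid sum4_swap_outer sum4_swap_inner sum4_swap_mid.
by rewrite sum4_swap_outer.
Qed.

(** The combination [2 * Y - Z - W] has sum 0. It is the way in which the second derivatives of [v]
    and [w] left over in [multiplier_identity] disappear. *)
Lemma sum4_cancel (E H G Y Z W : 'I_m -> 'I_m -> 'I_m -> 'I_m -> K) :
  (forall k j j' k', E k j j' k' =
    H k j j' k' + G k j j' k' + (2 * Y k j j' k' - Z k j j' k' - W k j j' k')) ->
  sum4 Y = sum4 W -> sum4 Z = sum4 W -> sum4 E = sum4 H + sum4 G.
Proof.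
move=> /eq_sum4 EE YW ZW; rewrite EE -!sum4D -!sum4N -sum4Z YW ZW; ring.
Qed.

End double_sums.

(** For [g] the gradient of [v], this is the second order part of the operator. *)
Definition divgrad (R : realType) (m : nat) (a : 'I_m -> 'I_m -> 'rV[R]_m.+1 -> R[i])
    (g : 'I_m -> 'rV[R]_m.+1 -> R[i]) p :=
  sum2 (fun j k => cpartial (lift ord0 k) (a j k * g j) p).

(** For [g] the gradient of [v], this is the derivative of [v] along the vector field [a grad l];
    [- 2] times it is the spatial first order term of I2. *)
Definition advect (R : realType) (m : nat) (a : 'I_m -> 'I_m -> 'rV[R]_m.+1 -> R[i])
    (lx g : 'I_m -> 'rV[R]_m.+1 -> R[i]) p :=
  sum2 (fun j k => a j k p * lx j p * g k p).

(* [w] plays the role of the conjugate of [v], but is treated as an independent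
   function: the identity is then polynomial in the derivatives.  [lt], [lx],
   [vt], [vx], ... are the derivatives of l, v, ... with respect to t and x. *)
Section identity.
Variables (R : realType) (m : nat).
Local Notation X := ('rV[R]_m.+1 -> R[i]).
Local Notation xi := (lift ord0).
Variables (a : 'I_m -> 'I_m -> X) (al be lt Ps v vt w wt : X).
Variables (lx Psx vx wx : 'I_m -> X).
Local Notation diffC f := (forall i p, is_cpartial i f p (cpartial i f p)).
Hypotheses (da : forall j k, diffC (a j k)) (dal : diffC al) (dbe : diffC be)
  (dlt : diffC lt) (dPs : diffC Ps) (dvt : diffC vt) (dwt : diffC wt)
  (dlx : forall j, diffC (lx j)) (dPsx : forall j, diffC (Psx j))
  (dvx : forall j, diffC (vx j)) (dwx : forall j, diffC (wx j)).
Hypothesis asym : forall j k, a j k = a k j.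
Hypotheses (v_t : forall p, is_cpartial ord0 v p (vt p))
  (v_x : forall k p, is_cpartial (xi k) v p (vx k p))
  (w_t : forall p, is_cpartial ord0 w p (wt p))
  (w_x : forall k p, is_cpartial (xi k) w p (wx k p))
  (Ps_x : forall k p, is_cpartial (xi k) Ps p (Psx k p)).
Hypotheses (vtx : forall k, cpartial (xi k) vt = cpartial ord0 (vx k))
  (vxx : forall j k, cpartial (xi j) (vx k) = cpartial (xi k) (vx j))
  (wtx : forall k, cpartial (xi k) wt = cpartial ord0 (wx k))
  (wxx : forall j k, cpartial (xi j) (wx k) = cpartial (xi k) (wx j)).

Lemma is_cpartial_sum2 i (F : 'I_m -> 'I_m -> X) p (D : 'I_m -> 'I_m -> R[i]) :
  (forall j k, is_cpartial i (F j k) p (D j k)) ->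
  is_cpartial i (\sum_j \sum_k F j k) p (sum2 D).
Proof. by move=> FD; apply: is_cpartial_sum => j; exact: is_cpartial_sum. Qed.

Lemma sum_cpartial_sum (F : 'I_m -> 'I_m -> X) p (D : 'I_m -> 'I_m -> R[i]) :
  (forall k j, is_cpartial (xi k) (F k j) p (D k j)) ->
  \sum_k cpartial (xi k) (\sum_j F k j) p = sum2 D.
Proof.
by move=> FD; apply: eq_bigr => k _; apply/is_cpartial_val/is_cpartial_sum.
Qed.

Lemma fct_sum2E (F : 'I_m -> 'I_m -> X) p :
  (\sum_j \sum_k F j k) p = sum2 (fun j k => F j k p).
Proof. by rewrite fct_sumE; apply: eq_bigr => j _; rewrite fct_sumE. Qed.

Ltac derive_cpartial := repeat (intros; match goal with
  | |- is_cpartial _ (@bigop.body _ _ _ _ _) _ _ =>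
      first [apply: is_cpartial_sum2 | apply: is_cpartial_sum]
  | |- is_cpartial _ (@GRing.mul _ _ _) _ _ => apply: is_cpartialM
  | |- is_cpartial _ (@Algebra.add _ _ (@Algebra.opp _ _)) _ _ => apply: is_cpartialB
  | |- is_cpartial _ (@Algebra.add _ _ _) _ _ => apply: is_cpartialD
  | |- is_cpartial _ (@Algebra.opp _ _) _ _ => apply: is_cpartialN
  | |- is_cpartial _ (@GRing.scale _ _ _ _) _ _ => apply: is_cpartialZ
  | |- _ => first [
    exact: v_t | exact: v_x | exact: w_t | exact: w_x | exact: Ps_x
  | exact: da | exact: dal | exact: dbe | exact: dlt | exact: dPs
  | exact: dvt | exact: dwt | exact: dlx | exact: dPsx | exact: dvx | exact: dwx ] end).

Local Notation L := (divgrad a vx).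
Local Notation Lw := (divgrad a wx).
Local Notation D := (advect a lx vx).
Local Notation Dw := (advect a lx wx).

(** Replaces the derivative of a product by its Leibniz expansion: the value is an existential
    variable, filled in by [derive_cpartial]. *)
Ltac expand_cpartial := repeat match goal with |- context [@cpartial ?R ?m ?i (?f * ?g) ?p] =>
  let d := fresh "d" in let H := fresh "H" in
  evar (d : R[i]); have H : is_cpartial i (f * g) p d;
  [rewrite /d; derive_cpartial | rewrite (is_cpartial_val H) /d; clear H d] end.

Ltac merge_sums := rewrite !(sum2Z, sum2Zr, sum2N, sum2D).

Let scaleE (c x : R[i]) : c *: x = c * x. Proof. by []. Qed.

Ltac expand_div := match goal with |- context [@cpartial ?R _ _ _ ?p] =>
  let d := fresh "d" in evar (d : 'I_m -> 'I_m -> R[i]);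
  rewrite (@sum_cpartial_sum _ p d); last (rewrite /d; derive_cpartial); rewrite /d {d} end.

(* [ring] compares its atoms up to conversion, which does not terminate in
   reasonable time on derivatives unless they are abstracted first. *)
Ltac ring_on_atoms :=
  repeat match goal with |- context [@cpartial ?R ?m ?i ?f ?p] =>
    generalize (@cpartial R m i f p); intro end;
  repeat match goal with q : matrix _ _ _ |- _ => match goal with
    |- context [?f q] => generalize (f q); intro end end;
  ring.

(** Both sides become one double sum; after symmetrization the claim for a fixed pair [j], [k] is
    polynomial in the values and derivatives at [p]. *)
Ltac compare_sums := let j := fresh "j" in let k := fresh "k" in
  rewrite /divgrad /advect ?fct_sum2E; merge_sums; apply: eq_sum2_sym => j k; expand_cpartial;
  rewrite ?fctE ?scaleE ?(asym k j) ?vtx ?wtx ?(vxx k j) ?(wxx k j); ring_on_atoms.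

(** * Divergence forms of the cross products of I1 and I2 *)

(** Compensates the products of [al * vt] and [al * wt] with the second order parts. The mixed
    derivatives produced by the time derivative of the quadratic form cancel those of the
    divergence. *)
Lemma alpha_flux_identity p :
  cpartial ord0 (al * \sum_j \sum_k a j k * vx j * wx k) p
  + \sum_k cpartial (xi k) (\sum_j - (al * a j k * (vx j * wt + wx j * vt))) p =
  sum2 (fun j k => cpartial ord0 (al * a j k) p * (vx k p * wx j p))
  - al p * (L p * wt p + Lw p * vt p)
  - sum2 (fun j k => a j k p * cpartial (xi k) al p * (vx j p * wt p + wx j p * vt p)).
Proof. by expand_cpartial; expand_div; compare_sums. Qed.

(** Compensates the products of [i be vt] and its conjugate with the multipliers [- 2 * Dw] and
    [- 2 * D]; the mixed derivatives of the time and space fluxes cancel again. *)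
Lemma beta_flux_identity p :
  cpartial ord0 (be * \sum_j \sum_k a j k * lx j * (wx k * v - vx k * w)) p
  + \sum_k cpartial (xi k) (\sum_j - (be * (a j k * lx j * (wt * v - w * vt)))) p =
  sum2 (fun j k => cpartial ord0 (be * a j k * lx j) p * (wx k p * v p - vx k p * w p))
  + sum2 (fun j k => cpartial (xi k) (be * a j k * lx j) p) * (w p * vt p - v p * wt p)
  + 2 * be p * (Dw p * vt p - D p * wt p).
Proof. by expand_cpartial; expand_div; compare_sums. Qed.

(** Compensates the products of the [be * lt] terms of I2 with the second order parts. The terms
    quadratic in the gradients are antisymmetric in [j], [k] and sum to 0. *)
Lemma beta_lt_flux_identity p :
  \sum_k cpartial (xi k) (\sum_j - (be * (a j k * lt * (vx j * w - wx j * v)))) p =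
  sum2 (fun j k => a j k p * cpartial (xi j) (be * lt) p * (wx k p * v p - vx k p * w p))
  - be p * lt p * (L p * w p - Lw p * v p).
Proof. by expand_div; compare_sums. Qed.

(** Compensates the products of [Ps * v] and [Ps * w] with the second order parts. The flux with
    [Psx] removes the first order terms that come from differentiating [Ps], at the price of a zero
    order term. *)
Lemma Psi_flux_identity p :
  \sum_k cpartial (xi k) (\sum_j (a j k * Psx j * (v * w)
      - Ps * a j k * (vx j * w + wx j * v))) p =
  sum2 (fun j k => cpartial (xi j) (a j k * Psx k) p) * (v p * w p)
  - Ps p * (L p * w p + Lw p * v p)
  - sum2 (fun j k => a j k p * Ps p * (vx k p * wx j p + wx k p * vx j p)).
Proof. by expand_div; compare_sums. Qed.

(** Compensates the products of [- al * lt * v] and its conjugate with the multipliers [- 2 * Dw]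
    and [- 2 * D]. *)
Lemma alpha_lt_flux_identity p :
  \sum_k cpartial (xi k) (\sum_j - (2 *: (a j k * (al * lx j * lt) * (v * w)))) p =
  - 2 * sum2 (fun j k => cpartial (xi k) (al * a j k * lx j * lt) p) * (v p * w p)
  - 2 * al p * lt p * (D p * w p + Dw p * v p).
Proof. by expand_div; compare_sums. Qed.

Lemma dt_sqnorm_flux p :
  cpartial ord0 ((al ^+ 2 + be ^+ 2) * lt * (v * w)) p =
  (cpartial ord0 (al ^+ 2 * lt) p + cpartial ord0 (be ^+ 2 * lt) p) * (v p * w p)
  + (al p ^+ 2 + be p ^+ 2) * lt p * (vt p * w p + v p * wt p).
Proof. by rewrite !expr2; expand_cpartial; rewrite !fctE; ring. Qed.

(** A Rellich type identity: it compensates the products of the second order parts with the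
    multipliers, and leaves only a quadratic form in the first derivatives. *)
Lemma multiplier_identity p :
  \sum_k cpartial (xi k) (\sum_j \sum_j' \sum_k'
      (2 *: (a j k' * a j' k) - a j k * a j' k') * lx j *
        (vx j' * wx k' + wx j' * vx k')) p =
  2 * (L p * Dw p + Lw p * D p)
  + sum2 (fun j k => sum2 (fun j' k' =>
      2 * (cpartial (xi k') (a j' k * lx j') p * a j k' p)
      - cpartial (xi k') (a j k * a j' k' * lx j') p) *
        (vx k p * wx j p + wx k p * vx j p)).
Proof.
pose E k j j' k' := cpartial (xi k) ((2 *: (a j k' * a j' k) - a j k * a j' k') *
  lx j * (vx j' * wx k' + wx j' * vx k')) p.
(* In the Leibniz rule [a j' k * vx j'] is kept whole, so that [L] appears. [H] collects the
   derivatives of that factor and of its [wx] analogue, [G] those of the coefficients carrying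
   [lx j]; the rest falls on a single [vx] or [wx]. *)
pose H k j j' k' := 2 * (cpartial (xi k) (a j' k * vx j') p * (a j k' p * lx j p * wx k' p)
  + cpartial (xi k) (a j' k * wx j') p * (a j k' p * lx j p * vx k' p)).
pose G k j j' k' := (2 * (cpartial (xi k) (a j k' * lx j) p * a j' k p)
      - cpartial (xi k) (a j' k' * a j k * lx j) p) *
        (vx k' p * wx j' p + wx k' p * vx j' p).
(* [Y], [Z] and [W] have the same sum: exchange k and k' in [Y], by the symmetry
   of second derivatives, and j' and k' in [Z], by that of [a]. *)
pose Y k j j' k' := a j k' p * a j' k p * lx j p *
  (vx j' p * cpartial (xi k) (wx k') p + wx j' p * cpartial (xi k) (vx k') p).
pose Z k j j' k' := a j k p * a j' k' p * lx j p *
  (cpartial (xi k) (vx j') p * wx k' p + cpartial (xi k) (wx j') p * vx k' p).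
pose W k j j' k' := a j k p * a j' k' p * lx j p *
  (vx j' p * cpartial (xi k) (wx k') p + wx j' p * cpartial (xi k) (vx k') p).
have EE k j j' k' : E k j j' k' =
    H k j j' k' + G k j j' k' + (2 * Y k j j' k' - Z k j j' k' - W k j j' k').
  by rewrite /E /H /G /Y /Z /W; expand_cpartial;
    rewrite ?fctE ?scaleE ?(asym k' j'); ring_on_atoms.
have YW : sum4 Y = sum4 W.
  rewrite sum4_swap_ends; apply: eq_sum4 => k j j' k'; rewrite /Y /W.
  by rewrite ?(vxx k k') ?(wxx k k'); ring_on_atoms.
have ZW : sum4 Z = sum4 W.
  rewrite sum4_swap_inner; apply: eq_sum4 => k j j' k'; rewrite /Z /W.
  by rewrite ?(asym k' j') ?(vxx k k') ?(wxx k k'); ring_on_atoms.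
transitivity (sum4 E).
  apply: sum_cpartial_sum => k j; apply: is_cpartial_sum2 => j' k'.
  by rewrite /E; expand_cpartial; derive_cpartial.
rewrite (sum4_cancel EE YW ZW); congr (_ + _); last first.
  rewrite -(sum4_exchange (fun j k j' k' => G k' j' j k)).
  by apply: eq_sum2 => j k; rewrite sum2Zr.
rewrite /divgrad /advect !sum2M sum4D sum4Z.
by rewrite [RHS]sum4_swap_outer [RHS]sum4_swap_mid.
Qed.

(* The parts of M and V without the terms containing A: unlike A, which is only
   continuous, they are of class C^1. *)
Definition fluxM0 : X :=
  (al ^+ 2 + be ^+ 2) * lt * (v * w)
  + al * (\sum_j \sum_k a j k * vx j * wx k)
  + 'i%C *: (be * (\sum_j \sum_k a j k * lx j * (wx k * v - vx k * w))).

Definition fluxV0 (k : 'I_m) : X :=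
  \sum_j
    (- ('i%C *: (be * (a j k * lx j * (wt * v - w * vt)
                       + a j k * lt * (vx j * w - wx j * v))))
     - al * a j k * (vx j * wt + wx j * vt)
     - Ps * a j k * (vx j * w + wx j * v)
     + a j k * (Psx j - 2 *: (al * lx j * lt)) * (v * w))
  + \sum_j \sum_j' \sum_k'
      (2 *: (a j k' * a j' k) - a j k * a j' k') * lx j
      * (vx j' * wx k' + wx j' * vx k').

Lemma cpartialD i (f g : X) p :
  (exists d, is_cpartial i f p d) -> (exists d, is_cpartial i g p d) ->
  cpartial i (f + g) p = cpartial i f p + cpartial i g p.
Proof.
move=> [d fd] [e ge]; rewrite (is_cpartial_val (is_cpartialD fd ge)).
by rewrite (is_cpartial_val fd) (is_cpartial_val ge).
Qed.

Lemma cpartialZ i c (f : X) p :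
  (exists d, is_cpartial i f p d) -> cpartial i (c *: f) p = c * cpartial i f p.
Proof.
by move=> [d fd]; rewrite (is_cpartial_val (is_cpartialZ c fd)) (is_cpartial_val fd).
Qed.

Lemma sum_cpartialD (F G : 'I_m -> X) p :
  (forall k, exists d, is_cpartial (xi k) (F k) p d) ->
  (forall k, exists d, is_cpartial (xi k) (G k) p d) ->
  \sum_k cpartial (xi k) (F k + G k) p =
  \sum_k cpartial (xi k) (F k) p + \sum_k cpartial (xi k) (G k) p.
Proof.
by move=> Fd Gd; rewrite -big_split /=; apply: eq_bigr => k _; exact: cpartialD.
Qed.

Lemma sum_cpartialZ c (F : 'I_m -> X) p :
  (forall k, exists d, is_cpartial (xi k) (F k) p d) ->
  \sum_k cpartial (xi k) (c *: F k) p = c * \sum_k cpartial (xi k) (F k) p.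
Proof.
by move=> Fd; rewrite mulr_sumr; apply: eq_bigr => k _; exact: cpartialZ.
Qed.

Lemma dt_fluxM0 p : cpartial ord0 fluxM0 p =
  cpartial ord0 ((al ^+ 2 + be ^+ 2) * lt * (v * w)) p
  + cpartial ord0 (al * (\sum_j \sum_k a j k * vx j * wx k)) p
  + 'i%C * cpartial ord0 (be * (\sum_j \sum_k a j k * lx j * (wx k * v - vx k * w))) p.
Proof.
rewrite /fluxM0 !expr2 -cpartialZ; last by eexists; derive_cpartial.
by rewrite !cpartialD//; eexists; derive_cpartial.
Qed.

(** Cuts the flux into six pieces, each matching one of the flux identities. *)
Lemma div_fluxV0 p :
  \sum_k cpartial (xi k) (fluxV0 k) p =
  'i%C * (\sum_k cpartial (xi k) (\sum_j - (be * (a j k * lx j * (wt * v - w * vt)))) p)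
  + ('i%C * (\sum_k cpartial (xi k) (\sum_j - (be * (a j k * lt * (vx j * w - wx j * v)))) p)
  + (\sum_k cpartial (xi k) (\sum_j - (al * a j k * (vx j * wt + wx j * vt))) p
  + (\sum_k cpartial (xi k) (\sum_j (a j k * Psx j * (v * w)
      - Ps * a j k * (vx j * w + wx j * v))) p
  + (\sum_k cpartial (xi k) (\sum_j - (2 *: (a j k * (al * lx j * lt) * (v * w)))) p
  + \sum_k cpartial (xi k) (\sum_j \sum_j' \sum_k'
      (2 *: (a j k' * a j' k) - a j k * a j' k') * lx j
      * (vx j' * wx k' + wx j' * vx k')) p)))).
Proof.
rewrite -sum_cpartialZ; last by move=> k; eexists; derive_cpartial.
rewrite -sum_cpartialZ; last by move=> k; eexists; derive_cpartial.
do 5 (rewrite -sum_cpartialD; [|by move=> k; eexists; derive_cpartial..]).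
apply: eq_bigr => k _.
apply: (congr1 (fun f => cpartial (xi k) f p)).
rewrite /fluxV0 !addrA; congr (_ + _).
rewrite !scaler_sumr -!big_split /=; apply: eq_bigr => j _.
apply/funext => q; rewrite !fctE !scaleE; ring_on_atoms.
Qed.

(** [A], [I1] and [J1] are numbers attached to [p], so nothing can differentiate [A]. The last three
    terms are the products of [A] with I2 and its conjugate; the classical and the distributional
    arguments absorb them in different ways. *)
Lemma weighted_identity (A I1 J1 : R[i]) p :
  I1 = 'i%C * (be p * vt p) - al p * lt p * v p + L p + A * v p ->
  J1 = - 'i%C * (be p * wt p) - al p * lt p * w p + Lw p + A * w p ->
  (I1 + (al p * vt p - 'i%C * (be p * lt p * v p) - 2 * D p + Ps p * v p)) * J1
  + (J1 + (al p * wt p + 'i%C * (be p * lt p * w p) - 2 * Dw p + Ps p * w p)) * I1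
  + cpartial ord0 fluxM0 p + \sum_k cpartial (xi k) (fluxV0 k) p =
  (2 * (I1 * J1)
  + sum2 (fun j k => (sum2 (fun j' k' =>
        2 * (cpartial (xi k') (a j' k * lx j') p * a j k' p)
        - cpartial (xi k') (a j k * a j' k' * lx j') p)
      + 2^-1 * cpartial ord0 (al * a j k) p - a j k p * Ps p)
      * (vx k p * wx j p + wx k p * vx j p))
  + 'i%C * sum2 (fun j k => (cpartial ord0 (be * a j k * lx j) p
        + a j k p * cpartial (xi j) (be * lt) p) * (wx k p * v p - vx k p * w p))
  - sum2 (fun j k => a j k p * cpartial (xi k) al p * (vx j p * wt p + wx j p * vt p))
  + 'i%C * ((be p * Ps p + sum2 (fun j k => cpartial (xi k) (be * a j k * lx j) p))
             * (w p * vt p - v p * wt p)))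
  + (cpartial ord0 (al ^+ 2 * lt) p + cpartial ord0 (be ^+ 2 * lt) p
    - 2 * (sum2 (fun j k => cpartial (xi k) (al * a j k * lx j * lt) p)
           + al p * Ps p * lt p)
    + sum2 (fun j k => cpartial (xi j) (a j k * Psx k) p)) * (v p * w p)
  + al p * A * (vt p * w p + v p * wt p)
  - 2 * A * (D p * w p + Dw p * v p)
  + 2 * (A * Ps p) * (v p * w p).
Proof.
move=> I1E J1E.
have ii : 'i%C * 'i%C + 1 = 0 :> R[i] by rewrite -expr2 sqr_i addNr.
have E1 : sum2 (fun j k => (sum2 (fun j' k' =>
        2 * (cpartial (xi k') (a j' k * lx j') p * a j k' p)
        - cpartial (xi k') (a j k * a j' k' * lx j') p)
      + 2^-1 * cpartial ord0 (al * a j k) p - a j k p * Ps p)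
      * (vx k p * wx j p + wx k p * vx j p)) =
   sum2 (fun j k => sum2 (fun j' k' =>
      2 * (cpartial (xi k') (a j' k * lx j') p * a j k' p)
      - cpartial (xi k') (a j k * a j' k' * lx j') p) *
        (vx k p * wx j p + wx k p * vx j p))
   + sum2 (fun j k => cpartial ord0 (al * a j k) p * (vx k p * wx j p))
   - sum2 (fun j k => a j k p * Ps p * (vx k p * wx j p + wx k p * vx j p)).
  (* The time derivative of the quadratic form gives [vx k * wx j] alone; the symmetry of [a] splits
     it into two halves, whence the factor [2^-1]. *)
  have -> : sum2 (fun j k => cpartial ord0 (al * a j k) p * (vx k p * wx j p)) =
      sum2 (fun j k => 2^-1 * (cpartial ord0 (al * a j k) p *
        (vx k p * wx j p + wx k p * vx j p))).
    apply: eq_sum2_sym => j k; rewrite (asym k j).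
    move: (cpartial _ _ _) (vx j p) (vx k p) (wx j p) (wx k p) => t x1 x2 y1 y2.
    by field.
  merge_sums; apply: eq_sum2 => j k.
  move: (sum2 _) (vx k p * _ + _) (cpartial _ _ _) => S Q t.
  ring.
have E3 : sum2 (fun j k => (cpartial ord0 (be * a j k * lx j) p
        + a j k p * cpartial (xi j) (be * lt) p) * (wx k p * v p - vx k p * w p)) =
  sum2 (fun j k => cpartial ord0 (be * a j k * lx j) p * (wx k p * v p - vx k p * w p))
  + sum2 (fun j k => a j k p * cpartial (xi j) (be * lt) p * (wx k p * v p - vx k p * w p)).
  by rewrite sum2D; apply: eq_sum2 => j k; rewrite mulrDl.
rewrite dt_fluxM0 div_fluxV0 dt_sqnorm_flux beta_lt_flux_identity.
rewrite Psi_flux_identity alpha_lt_flux_identity multiplier_identity.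
(* These two identities couple a time flux with a space flux. Each is solved for the divergence, and
   its time derivative then cancels the one coming from [fluxM0]. *)
have /(canRL (addKr _)) alphaE := alpha_flux_identity p.
have /(canRL (addKr _)) betaE := beta_flux_identity p.
rewrite {}alphaE {}betaE {}E1 {}E3 {}I1E {}J1E.
repeat match goal with |- context [sum2 ?F] => generalize (sum2 F); intro end.
repeat match goal with |- context [@cpartial ?R ?m ?i ?f ?p] =>
  generalize (@cpartial R m i f p); intro end.
move: (L p) (Lw p) (D p) (Dw p) => Lp Lwp Dp Dwp.
move: (al p) (be p) (lt p) (Ps p) (v p) (vt p) (w p) (wt p) => x1 b l Q y yt u ut.
move: ii; set I := 'i%C; move: I => I II.
apply/eqP; rewrite -subr_eq0; apply/eqP.
(* The only place where the square of [i] matters: the product of the [be * vt] and [be * lt * v]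
   terms must cancel the [be ^+ 2] part of [dt_sqnorm_flux]. *)
rewrite (_ : _ - _ = (I * I + 1) * (b ^+ 2 * l * (yt * u + y * ut))).
  by rewrite II mul0r.
ring.
Qed.

End identity.

(** * Transfer to the functions of the statement *)

Section complexf_morphism.
Variables (R : realType) (m : nat).
Local Notation XR := ('rV[R]_m.+1 -> R).
Implicit Types f g : XR.

Lemma complexfD f g : (f + g)%:Cf = f%:Cf + g%:Cf.
Proof. by apply/funext => p; exact: (rmorphD (real_complex R)). Qed.

Lemma complexfN f : (- f)%:Cf = - f%:Cf.
Proof. by apply/funext => p; exact: (rmorphN (real_complex R)). Qed.

Lemma complexfM f g : (f * g)%:Cf = f%:Cf * g%:Cf.
Proof. by apply/funext => p; exact: (rmorphM (real_complex R)). Qed.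

Lemma real_complexMn n (x : R) : (n%:R * x)%:C%C = n%:R * x%:C%C :> R[i].
Proof.
have <- : (n%:R : R)%:C%C = n%:R := rmorph_nat (real_complex R) n.
exact: (rmorphM (real_complex R)).
Qed.

Lemma complexfZ n f : (n%:R *: f)%:Cf = n%:R *: f%:Cf.
Proof. by apply/funext => p; exact: real_complexMn. Qed.

Lemma complexfZV n f : (n%:R^-1 *: f)%:Cf = n%:R^-1 *: f%:Cf.
Proof.
apply/funext => p; rewrite /complexf -[RHS]/(n%:R^-1 * (f p)%:C%C).
have <- : (n%:R : R)%:C%C = n%:R := rmorph_nat (real_complex R) n.
rewrite -(fmorphV (real_complex R)).
exact: (rmorphM (real_complex R)).
Qed.

Lemma complexfX n f : (f ^+ n)%:Cf = f%:Cf ^+ n.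
Proof.
elim: n => [|n IH]; last by rewrite !exprS complexfM IH.
by apply/funext => p; exact: (rmorph1 (real_complex R)).
Qed.

Lemma complexf_sum n (F : 'I_n -> XR) : (\sum_j F j)%:Cf = \sum_j (F j)%:Cf.
Proof.
apply: (big_morph _ complexfD).
by apply/funext => p; exact: (rmorph0 (real_complex R)).
Qed.

Lemma complexf_sum2 n (F : 'I_n -> 'I_n -> XR) :
  (\sum_j \sum_k F j k)%:Cf = \sum_j \sum_k (F j k)%:Cf.
Proof. by rewrite complexf_sum; apply: eq_bigr => j _; rewrite complexf_sum. Qed.

Lemma complexf_dx k f : (dx k f)%:Cf = cpartial (lift ord0 k) f%:Cf.
Proof. by rewrite cpartial_complexf. Qed.

Lemma complexf_dt f : (dt f)%:Cf = cpartial ord0 f%:Cf.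
Proof. by rewrite cpartial_complexf. Qed.

Lemma sqnormfE (v : 'rV[R]_m.+1 -> R[i]) : sqnormf v = v * conjf v.
Proof. by apply/funext => p; rewrite /sqnormf sqr_normc. Qed.

Lemma Ck2_C1C f : Ck 2 f -> C1C f%:Cf.
Proof. by move=> [cf df d2f]; apply: C1C_complexf; split=> // i; have [] := d2f i. Qed.

Lemma Ck2_C1C_cpartial f i : Ck 2 f -> C1C (cpartial i f%:Cf).
Proof. by move=> [_ _ d2f]; rewrite cpartial_complexf; apply: C1C_complexf. Qed.

Lemma C12_C1C f : C12 f -> C1C f%:Cf.
Proof. by move=> [cf [df cdf] _ _]; apply: C1C_complexf; split. Qed.

Lemma cCk2_C1C (v : 'rV[R]_m.+1 -> R[i]) : cCk 2 v -> C1C v.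
Proof.
move=> [[c1 d1 e1] [c2 d2 e2]]; apply/C1CE.
by split; split=> // i; [have [] := e1 i|have [] := e2 i].
Qed.

Lemma cCk2_C1C_cpartial (v : 'rV[R]_m.+1 -> R[i]) i : cCk 2 v -> C1C (cpartial i v).
Proof.
by move=> [[c1 d1 e1] [c2 d2 e2]]; apply/C1CE; split; [exact: e1|exact: e2].
Qed.

Lemma cpartial_swap (v : 'rV[R]_m.+1 -> R[i]) i j : cCk 2 v ->
  cpartial i (cpartial j v) = cpartial j (cpartial i v).
Proof.
have swap (f : XR) : Ck 2 f -> partial i (partial j f) = partial j (partial i f).
  move=> [_ df ddf]; apply/funext => p; apply: derive_swap.
  - by move=> q; exact: df.
  - by move=> q; exact: df.
  - by move=> q; have [_ + _] := ddf j; apply.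
  - by move=> q; have [_ + _] := ddf i; apply.
  - by have [_ _ /(_ i)] := ddf j; apply.
  - by have [_ _ /(_ j)] := ddf i; apply.
move=> [h1 h2]; apply/funext => p.
have E1 := congr1 (@^~ p) (swap _ h1); have E2 := congr1 (@^~ p) (swap _ h2).
exact: (f_equal2 (@Complex R) E1 E2).
Qed.

(** Only a derivative in the direction [u] is given, so the one-variable chain rule is applied on
    the line through [p], at parameter 0. *)
Lemma is_derive_expR_comp (l : XR) p (u : 'rV[R]_m.+1) : derivable l p u ->
  is_derive p u (expR \o l) (expR (l p) * 'D_u l p).
Proof.
move=> dl.
have p0 : p + (0 : R) *: u = p by rewrite scale0r addr0.
have dl0 : derivable l (p + (0 : R) *: u) u by rewrite p0.
have h : is_derive (0 : R) (1 : R) (fun s : R => expR (l (p + s *: u)))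
    (expR (l p) * 'D_u l p).
  have := is_derive1_comp (is_derive_expR _) (is_derive_line dl0).
  by rewrite p0.
case: h => h1 h2.
have E : (fun h : R => h^-1 *: ((fun s => expR (l (p + s *: u))) (h *: 1 + 0) -
     expR (l (p + 0 *: u)))) =
  (fun h : R => h^-1 *: ((expR \o l) (h *: u + p) - (expR \o l) p)).
  by apply/funext => h; rewrite /= p0 addr0 (_ : h *: 1 = h) ?(addrC p)//; exact: mulr1.
apply: DeriveDef.
  exact: (eq_ind _ (fun q : R -> R => cvg (q @ 0^')) h1 _ E).
exact: (eq_ind _ (fun q : R -> R => lim (q @ 0^') = _) h2 _ E).
Qed.

End complexf_morphism.

(** * Term by term integration of compactly supported functions *)

Section integral_calculus.
Variables (R : realType) (m : nat) (L : R).
Hypothesis L0 : 0 <= L.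
Local Notation X := ('rV[R]_m.+1 -> R[i]).
Implicit Types f g phi : X.

(** Each value travels with the regularity that additivity asks for, so that a long integrand is
    integrated by composing the rules along its expression. *)
Definition has_cintegral f c := ccontinuous L f /\ cintegral f = c.

Lemma has_cintegralD f g c d : has_cintegral f c -> has_cintegral g d ->
  has_cintegral (f + g) (c + d).
Proof.
move=> [fc <-] [gc <-]; split; first exact: ccontinuousD.
exact: cintegralD L0 fc gc.
Qed.

Lemma has_cintegralN f c : has_cintegral f c -> has_cintegral (- f) (- c).
Proof.
by move=> [fc <-]; split; [exact: ccontinuousN|exact: cintegralN L0 fc].
Qed.

Lemma has_cintegralB f g c d : has_cintegral f c -> has_cintegral g d ->
  has_cintegral (f - g) (c - d).
Proof. by move=> fc gd; apply: has_cintegralD => //; exact: has_cintegralN. Qed.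

Lemma has_cintegralZ b f c : has_cintegral f c -> has_cintegral (b *: f) (b * c).
Proof.
by move=> [fc <-]; split; [exact: ccontinuousZ|exact: cintegralZ L0 fc].
Qed.

Lemma has_cintegral_sum n (F : 'I_n -> X) (C : 'I_n -> R[i]) :
  (forall j, has_cintegral (F j) (C j)) -> has_cintegral (\sum_j F j) (\sum_j C j).
Proof.
move=> FC; split; first by apply: ccontinuous_sum => j; exact: (FC j).1.
rewrite (cintegral_sum L0) => [|j]; last exact: (FC j).1.
by apply: eq_bigr => j _; exact: (FC j).2.
Qed.

Lemma has_cintegralM f phi : continuousC f -> ccontinuous L phi ->
  has_cintegral (f * phi) (cintegral (f * phi)).
Proof. by move=> fc phic; split=> //; exact: ccontinuousMl. Qed.

Lemma has_cintegral_cpartial i f phi : C1C f -> C1C phi ->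
  (forall p, L < `|p| -> phi p = 0) -> has_cintegral (cpartial i (f * phi)) 0.
Proof.
move=> f1 phi1 phi0.
have f0 p : L < `|p| -> (f * phi) p = 0.
  by move=> Lp; rewrite -[LHS]/(f p * phi p) phi0// mulr0.
split; first exact: cpartial_ccontinuous (C1CM f1 phi1) f0.
exact: cintegral_cpartial L0 (C1CM f1 phi1) f0.
Qed.

End integral_calculus.

Lemma test_function_support (R : realType) (m : nat) (phi : 'rV[R]_m.+1 -> R[i]) :
  test_function phi -> exists2 L, 0 <= L & forall p, L < `|p| -> phi p = 0.
Proof.
move=> [_ /compact_bounded[M [_ hM]]].
exists (`|M| + 1); first by rewrite addr_ge0.
move=> p Lp; apply/eqP/negPn/negP => phip.
have M1 : M < `|M| + 1 by rewrite (le_lt_trans (ler_norm M))// ltrDl.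
have := hM _ M1 p (@subset_closure _ [set p | phi p != 0] p phip).
by rewrite /= leNgt Lp.
Qed.

(** * The operator conjugated by the weight, and the two conclusions *)

Section weighted_operator.
Variables (R : realType) (m : nat).
Local Notation XR := ('rV[R]_m.+1 -> R).
Local Notation X := ('rV[R]_m.+1 -> R[i]).
Local Notation xi := (lift ord0).
Variables (alpha beta : XR) (a : 'I_m -> 'I_m -> XR) (z v : X) (Psi l theta : XR).
Hypotheses (halpha : Ck 2 alpha) (hbeta : Ck 2 beta)
    (ha : forall j k, C12 (a j k)) (hasym : forall j k, a j k = a k j)
    (hz : cCk 2 z) (hv : cCk 2 v) (hPsi : Ck 2 Psi) (hl : Ck 2 l)
    (htheta : theta = expR \o l) (hvz : v = theta%:Cf * z).

Local Notation ca := (fun j k => (a j k)%:Cf).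
Local Notation al := (alpha%:Cf).
Local Notation be := (beta%:Cf).
Local Notation lt := (cpartial ord0 l%:Cf).
Local Notation lx := (fun j => cpartial (xi j) l%:Cf).
Local Notation Ps := (Psi%:Cf).
Local Notation Psx := (fun j => cpartial (xi j) Psi%:Cf).
Local Notation vt := (cdt v).
Local Notation vx := (fun j => cdx j v).
Local Notation w := (conjf v).
Local Notation wt := (cdt (conjf v)).
Local Notation wx := (fun j => cdx j (conjf v)).
Local Notation A := (fA a Psi l).

Let C1a j k : C1C (a j k)%:Cf. Proof. exact: C12_C1C. Qed.
Let C1al : C1C al. Proof. exact: Ck2_C1C. Qed.
Let C1be : C1C be. Proof. exact: Ck2_C1C. Qed.
Let C1Ps : C1C Ps. Proof. exact: Ck2_C1C. Qed.
Let C1l : C1C l%:Cf. Proof. exact: Ck2_C1C. Qed.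
Let C1li i : C1C (cpartial i l%:Cf). Proof. exact: Ck2_C1C_cpartial. Qed.
Let C1Psi i : C1C (cpartial i Psi%:Cf). Proof. exact: Ck2_C1C_cpartial. Qed.
Let C1v : C1C v. Proof. exact: cCk2_C1C. Qed.
Let C1z : C1C z. Proof. exact: cCk2_C1C. Qed.
Let C1vi i : C1C (cpartial i v). Proof. exact: cCk2_C1C_cpartial. Qed.
Let C1zi i : C1C (cpartial i z). Proof. exact: cCk2_C1C_cpartial. Qed.
Let C1w : C1C w. Proof. exact: C1C_conjf. Qed.
Let wiE i : cpartial i w = conjf (cpartial i v). Proof. exact: cpartial_conjf. Qed.
Let C1wi i : C1C (cpartial i w). Proof. rewrite wiE; exact/C1C_conjf/C1vi. Qed.

Let is_cpC1 i (f : X) p : C1C f -> is_cpartial i f p (cpartial i f p).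
Proof. by case. Qed.

Let w_swap i j : cpartial i (cpartial j w) = cpartial j (cpartial i w).
Proof.
rewrite (wiE j) (wiE i) (cpartial_conjf i (C1vi j)).
by rewrite (cpartial_conjf j (C1vi i)) (cpartial_swap i j hv).
Qed.

Lemma fA_complexE p : (A p)%:C%C =
  sum2 (fun j k => ca j k p * lx j p * lx k p)
  - sum2 (fun j k => cpartial (xi k) (ca j k * lx j) p) - Ps p.
Proof.
rewrite -[LHS]/(A%:Cf p) /fA !(complexfD, complexfN) !complexf_sum2.
rewrite fctE; congr (_ - _); rewrite fctE; congr (_ - _).
  rewrite fct_sum2E; apply: eq_sum2 => j k.
  by rewrite !complexfM !complexf_dx.
rewrite -[LHS]/((\sum_j \sum_k _) p) fct_sum2E; apply: eq_sum2 => j k.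
by rewrite complexf_dx complexfM complexf_dx.
Qed.

Lemma fI1E p : fI1 alpha beta a Psi l v p =
  'i%C * (be p * vt p) - al p * lt p * v p + divgrad ca vx p + (A p)%:C%C * v p.
Proof.
rewrite /fI1 complexfM complexf_dt fctE; congr (_ + _); rewrite fctE; congr (_ + _).
by rewrite fct_sum2E.
Qed.

Let conjM (x y : R[i]) : conjc (x * y) = conjc x * conjc y. Proof. exact: rmorphM. Qed.
Let conjD (x y : R[i]) : conjc (x + y) = conjc x + conjc y. Proof. exact: rmorphD. Qed.
Let conjN (x : R[i]) : conjc (- x) = - conjc x. Proof. exact: rmorphN. Qed.
Let conjR (x : R) : conjc (x%:C)%C = (x%:C)%C. Proof. by rewrite /= oppr0. Qed.
Let conj_sum2 (F : 'I_m -> 'I_m -> R[i]) :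
  conjc (sum2 F) = sum2 (fun j k => conjc (F j k)).
Proof. by rewrite /sum2 rmorph_sum; apply: eq_bigr => j _; rewrite rmorph_sum. Qed.
Let conjcf (f : XR) : conjf f%:Cf = f%:Cf.
Proof. by apply/funext => p; exact: conjR. Qed.
Let conjcfE (f : XR) p : conjc (f%:Cf p) = f%:Cf p. Proof. exact: conjR. Qed.
Let conjfM (f g : X) : conjf (f * g) = conjf f * conjf g.
Proof. by apply/funext => p; exact: conjM. Qed.

Lemma conj_divgrad p : conjc (divgrad ca vx p) = divgrad ca wx p.
Proof.
rewrite /divgrad conj_sum2; apply: eq_sum2 => j k.
have H := cpartial_conjf (xi k) (C1CM (C1a j k) (C1vi (xi j))).
have E : conjf (ca j k * cdx j v) = ca j k * cdx j w.
  by rewrite (conjfM (a j k)%:Cf) conjcf; congr (_ * _); exact: esym (wiE _).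
exact: etrans (esym (congr1 (@^~ p) H)) (congr1 (fun f => cpartial (xi k) f p) E).
Qed.

Lemma conj_fI1E p : conjc (fI1 alpha beta a Psi l v p) =
  - 'i%C * (be p * wt p) - al p * lt p * w p + divgrad ca wx p + (A p)%:C%C * w p.
Proof.
have Et : conjc (cdt v p) = cdt w p := esym (congr1 (@^~ p) (wiE ord0)).
have Ei : conjc 'i%C = - 'i%C :> R[i].
  by apply/eqP; rewrite eq_complex /= oppr0 !eqxx.
rewrite fI1E !(conjD, conjN, conjM) conj_divgrad Et Ei.
by rewrite cpartial_complexf !conjcfE.
Qed.

Let theta_partial i : cpartial i theta%:Cf = theta%:Cf * cpartial i l%:Cf.
Proof.
rewrite !cpartial_complexf -complexfM; congr complexf; apply/funext => p.
rewrite htheta; have [_ dl _] := hl.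
exact: (@derive_val _ _ _ _ _ _ _ (is_derive_expR_comp (dl p i))).
Qed.

Let C1theta : C1C theta%:Cf.
Proof.
have [_ dl _] := hl; have [[cl _] _ _] := C1l.
have cth : continuousC theta%:Cf.
  split; last exact: cst_continuous.
  move=> p; rewrite htheta; apply: continuous_comp; [exact: cl|exact: continuous_expR].
apply: (@C1C_intro _ _ _ (fun i => theta%:Cf * cpartial i l%:Cf)) => //.
  move=> i p; rewrite cpartial_complexf -complexfM; split; last exact: is_derive_cst.
  by rewrite htheta; exact: (is_derive_expR_comp (dl p i)).
by move=> i; have [ci _ _] := C1li i; exact: continuousCM cth ci.
Qed.

Let v_partial i p : cpartial i v p = theta%:Cf p * (cpartial i z p + cpartial i l%:Cf p * z p).
Proof.
rewrite hvz cpartialM// theta_partial !fctE; ring.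
Qed.

(** [theta a z_j] equals [a v_j - a l_j v]; both sides are differentiated in [x_k] and the wanted
    term is isolated. After summation the two terms with [vx] add up to [- 2] times [advect]. *)
Let theta_divgrad_z p j k :
  theta%:Cf p * cpartial (xi k) (ca j k * cdx j z) p =
  cpartial (xi k) (ca j k * cdx j v) p - cpartial (xi k) (ca j k * lx j) p * v p
  - ca j k p * lx j p * vx k p - ca j k p * lx k p * vx j p
  + ca j k p * lx j p * lx k p * v p.
Proof.
have E : theta%:Cf * (ca j k * cdx j z) = ca j k * cdx j v - (ca j k * lx j) * v.
  apply/funext => q; rewrite !fctE /cdx v_partial hvz !fctE.
  move: (theta%:Cf q) (cpartial _ _ q) (cpartial _ _ q) (ca j k q) (z q).
  by move=> t x1 x2 x3 x4; ring.
have D1 : is_cpartial (xi k) (theta%:Cf * (ca j k * cdx j z)) p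
    (theta%:Cf p * lx k p * (ca j k * cdx j z) p +
     theta%:Cf p * cpartial (xi k) (ca j k * cdx j z) p).
  apply: is_cpartialM; last exact: is_cpC1 (C1CM (C1a j k) (C1zi (xi j))).
  have := is_cpC1 (xi k) p C1theta; rewrite theta_partial; exact.
have D2 : is_cpartial (xi k) (ca j k * cdx j v - (ca j k * lx j) * v) p
    (cpartial (xi k) (ca j k * cdx j v) p -
     (cpartial (xi k) (ca j k * lx j) p * v p + (ca j k * lx j) p * vx k p)).
  apply: is_cpartialB; first exact: is_cpC1 (C1CM (C1a j k) (C1vi (xi j))).
  apply: is_cpartialM; first exact: is_cpC1 (C1CM (C1a j k) (C1li (xi j))).
  exact: is_cpC1 C1v.
have := is_cpartial_val D2; rewrite -E (is_cpartial_val D1) !fctE => /(canRL (addKr _)) ->.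
have := v_partial (xi j) p; rewrite /cdx => ->.
have -> : v p = theta%:Cf p * z p by rewrite hvz.
repeat match goal with |- context [@cpartial ?R ?m ?i ?f ?p] =>
  generalize (@cpartial R m i f p); intro end.
move: (theta%:Cf p) (ca j k p) (z p) => x1 x2 x3; ring.
Qed.

Let opPE p : opP alpha beta a z p = (al p + 'i%C * be p) * cdt z p
  + sum2 (fun j k => cpartial (xi k) (ca j k * cdx j z) p).
Proof.
transitivity ((al p + 'i%C * be p) * cdt z p
  + (\sum_(j < m) \sum_(k < m) cdx k (ca j k * cdx j z)) p); first by [].
by rewrite fct_sum2E.
Qed.

(** The free function [Psi] enters I1 through [A] with a minus sign and I2 with a plus sign, so it
    drops out of the sum. *)
Lemma theta_opP p : theta%:Cf p * opP alpha beta a z p =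
  fI1 alpha beta a Psi l v p +
  (al p * vt p - 'i%C * (be p * lt p * v p) - 2 * advect ca lx vx p + Ps p * v p).
Proof.
rewrite fI1E fA_complexE opPE mulrDr sum2Z.
have -> : sum2 (fun j k => theta%:Cf p * cpartial (xi k) (ca j k * cdx j z) p) =
    divgrad ca vx p - sum2 (fun j k => cpartial (xi k) (ca j k * lx j) p) * v p
    - 2 * advect ca lx vx p + sum2 (fun j k => ca j k p * lx j p * lx k p) * v p.
  rewrite (eq_sum2 (theta_divgrad_z p)) /divgrad /advect !(sum2Z, sum2Zr, sum2N, sum2D).
  apply: eq_sum2_sym => j k; rewrite (hasym k j).
  repeat match goal with |- context [@cpartial ?R ?m ?i ?f ?p] =>
    generalize (@cpartial R m i f p); intro end.
  move: (ca j k p) (v p) (vx j p) (vx k p) => x1 x2 x3 x4; ring.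
have -> : vt p = theta%:Cf p * (cpartial ord0 z p + lt p * z p) := v_partial ord0 p.
have -> : v p = theta%:Cf p * z p by rewrite hvz.
move: (sum2 _) (sum2 _) (divgrad _ _ _) (advect _ _ _ _) => x8 x9 x10 x11.
rewrite /cdt; move: (cpartial ord0 z p) (lt p) (theta%:Cf p) (z p) (al p) (be p) (Ps p).
move=> x1 x2 x3 x4 x5 x6 x7; move: ('i%C) => I.
ring.
Qed.

Local Notation M0 := (fluxM0 ca al be lt v w lx vx wx).
Local Notation V0 := (fluxV0 ca al be lt Ps v vt w wt lx Psx vx wx).
Local Notation sq := (v * w).

(** Isolates the part of [fM] that is merely continuous; [fVE] does the same for the flux. *)
Lemma fME : fM alpha beta a Psi l v = M0 - (alpha * A)%:Cf * sq.
Proof.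
rewrite /fM /fluxM0 sqnormfE.
have -> : \sum_(j < m) \sum_(k < m)
    (a j k * dx j l)%:Cf * (cdx k w * v - cdx k v * w) =
    \sum_j \sum_k ca j k * lx j * (wx k * v - vx k * w).
  by apply: eq_bigr => j _; apply: eq_bigr => k _; rewrite complexfM complexf_dx.
rewrite complexfD complexfN !complexfM complexfD !complexfX complexf_dt mulrBl.
by rewrite -!addrA; congr (_ + _); rewrite addrC -addrA.
Qed.

Lemma fVE k : fV alpha beta a Psi l v k =
  V0 k + \sum_j 2 *: ((a j k * dx j l * A)%:Cf * sq).
Proof.
rewrite /fV /fluxV0 sqnormfE; move: (fA a Psi l) => B.
rewrite [RHS]addrAC -[in RHS]big_split /=; congr (_ + _).
  apply: eq_bigr => j _.
  have -> : (a j k * (2 *: (B * dx j l) + dx j Psi - 2 *: (alpha * dx j l * dt l)))%:Cf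
      = ca j k * (2 *: (B%:Cf * lx j) + Psx j - 2 *: (al * lx j * lt)).
    rewrite (complexfM (a j k)) (complexfD (2 *: (B * dx j l) + dx j Psi)).
    rewrite (complexfD (2 *: (B * dx j l))) (complexfN (2 *: _)).
    rewrite (complexfZ 2 (B * dx j l)) (complexfZ 2 (alpha * dx j l * dt l)).
    rewrite (complexfM B) (complexfM (alpha * dx j l)) (complexfM alpha).
    by rewrite (complexf_dx j l) (complexf_dx j Psi) (complexf_dt l).
  rewrite (complexfM (a j k) (dt l)) (complexfM alpha (a j k)) (complexfM Psi).
  rewrite (complexfM (a j k * dx j l)) (complexfM (a j k) (dx j l)).
  rewrite (complexf_dx j l) (complexf_dt l).
  rewrite -[RHS]addrA; congr (_ + _).
  rewrite -[X in ca j k * X]addrA mulrDr mulrDl [LHS]addrC; congr (_ + _).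
  apply/funext => p.
  rewrite -[LHS]/(ca j k p * (2 * (B%:Cf p * lx j p)) * (v p * w p)).
  rewrite -[RHS]/(2 * (ca j k p * lx j p * B%:Cf p * (v p * w p))).
  move: (ca j k p) (lx j p) (v p) (w p) (B%:Cf p) => x1 x2 x3 x4 x5; ring.
apply: eq_bigr => j _; apply: eq_bigr => j' _; apply: eq_bigr => k' _.
congr (_ * _).
rewrite (complexfM _ (dx j l)) (complexfD (2 *: _)) (complexfN (a j k * _)).
rewrite (complexfZ 2 (a j k' * _)) (complexfM (a j k')).
by rewrite (complexfM (a j k)) (complexf_dx j l).
Qed.

Lemma rhs_without_BE p : rhs_without_B alpha beta a Psi l v p =
  2 * (fI1 alpha beta a Psi l v p * conjc (fI1 alpha beta a Psi l v p))
  + sum2 (fun j k => (sum2 (fun j' k' =>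
        2 * (cpartial (xi k') (ca j' k * lx j') p * ca j k' p)
        - cpartial (xi k') (ca j k * ca j' k' * lx j') p)
      + 2^-1 * cpartial ord0 (al * ca j k) p - ca j k p * Ps p)
      * (vx k p * wx j p + wx k p * vx j p))
  + 'i%C * sum2 (fun j k => (cpartial ord0 (be * ca j k * lx j) p
        + ca j k p * cpartial (xi j) (be * lt) p) * (wx k p * v p - vx k p * w p))
  - sum2 (fun j k => ca j k p * cpartial (xi k) al p * (vx j p * wt p + wx j p * vt p))
  + 'i%C * ((be p * Ps p + sum2 (fun j k => cpartial (xi k) (be * ca j k * lx j) p))
             * (w p * vt p - v p * wt p)).
Proof.
rewrite /rhs_without_B fctE; congr (_ + _); last first.
  rewrite -[LHS]/('i%C * (_ * (w p * vt p - v p * wt p))); congr (_ * (_ * _)).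
  rewrite (complexfD (beta * Psi)) (complexfM beta Psi) complexf_sum2 fctE; congr (_ + _).
  rewrite fct_sum2E; apply: eq_sum2 => j k.
  rewrite (complexf_dx k (beta * a j k * dx j l)) (complexfM (beta * a j k)).
  by rewrite (complexfM beta) (complexf_dx j l).
rewrite fctE; congr (_ - _); last first.
  rewrite -[LHS]/((\sum_j \sum_k _) p) fct_sum2E; apply: eq_sum2 => j k.
  by rewrite (complexfM (a j k)) (complexf_dx k alpha).
rewrite fctE; congr (_ + _); last first.
  rewrite -[LHS]/('i%C * (\sum_j \sum_k _) p) fct_sum2E; congr (_ * _).
  apply: eq_sum2 => j k.
  rewrite (complexfD (dt _)) (complexf_dt (beta * a j k * dx j l)).
  rewrite (complexfM (a j k)) (complexf_dx j (beta * dt l)) (complexfM beta (dt l)).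
  by rewrite (complexfM (beta * a j k)) (complexfM beta) (complexf_dx j l) (complexf_dt l).
rewrite fctE; congr (_ + _).
  by rewrite sqnormfE.
rewrite fct_sum2E; apply: eq_sum2 => j k.
rewrite (complexfD _ (- (a j k * Psi))) (complexfD _ (2^-1 *: _)) (complexfN (a j k * Psi)).
rewrite (complexfZV 2) complexf_sum2 (complexf_dt (alpha * a j k)).
rewrite (complexfM alpha) (complexfM (a j k)).
rewrite -[LHS]/((((\sum_(j' < m) \sum_(k' < m) _) p + _) - _) * _) fct_sum2E.
congr (_ * _); congr (_ - _); congr (_ + _).
apply: eq_sum2 => j' k'.
rewrite (complexfD (2 *: _)) (complexfN (dx k' _)) (complexfZ 2 (dx k' _ * _)).
rewrite (complexfM (dx k' _)) (complexf_dx k' (a j' k * _)) (complexf_dx k' (a j k * _ * _)).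
rewrite (complexfM (a j' k)) (complexfM (a j k * a j' k')) (complexfM (a j k)).
by rewrite (complexf_dx j' l).
Qed.

Let conj_advect p : conjc (advect ca lx vx p) = advect ca lx wx p.
Proof.
rewrite /advect conj_sum2; apply: eq_sum2 => j k; rewrite !conjM conjcfE.
rewrite cpartial_complexf conjcfE; congr (_ * _).
exact: esym (congr1 (@^~ p) (wiE (xi k))).
Qed.

Let conj_theta_opP p : theta%:Cf p * conjc (opP alpha beta a z p) =
  conjc (fI1 alpha beta a Psi l v p) +
  (al p * wt p + 'i%C * (be p * lt p * w p) - 2 * advect ca lx wx p + Ps p * w p).
Proof.
have Et : conjc (cdt v p) = cdt w p := esym (congr1 (@^~ p) (wiE ord0)).
have Ei : conjc 'i%C = - 'i%C :> R[i].
  by apply/eqP; rewrite eq_complex /= oppr0 !eqxx.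
have E2 : conjc (2 : R[i]) = 2 by exact: rmorph_nat.
rewrite -[X in X * _](conjcfE theta) -conjM theta_opP conjD; congr (_ + _).
rewrite (conjD _ (Ps p * v p)) (conjD _ (- (2 * _))) (conjD (al p * vt p)) !conjN !conjM.
rewrite conj_advect Et Ei E2 cpartial_complexf !conjcfE.
by rewrite mulNr opprK.
Qed.

(** [B] without the terms containing [A]; every derivative left acts on a C^1 function. *)
Definition regular_B p : R[i] :=
  cpartial ord0 (al ^+ 2 * lt) p + cpartial ord0 (be ^+ 2 * lt) p
    - 2 * (sum2 (fun j k => cpartial (xi k) (al * ca j k * lx j * lt) p)
           + al p * Ps p * lt p)
    + sum2 (fun j k => cpartial (xi j) (ca j k * Psx k) p).

Lemma regular_identity p :
  theta%:Cf p * (opP alpha beta a z p * conjc (fI1 alpha beta a Psi l v p)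
     + conjc (opP alpha beta a z p) * fI1 alpha beta a Psi l v p)
  + cpartial ord0 M0 p + \sum_k cpartial (xi k) (V0 k) p =
  rhs_without_B alpha beta a Psi l v p + regular_B p * (v p * w p)
  + al p * A%:Cf p * (vt p * w p + v p * wt p)
  - 2 * A%:Cf p * (advect ca lx vx p * w p + advect ca lx wx p * v p)
  + 2 * (A%:Cf p * Ps p) * (v p * w p).
Proof.
have H := weighted_identity
  (fun j k i p => is_cpC1 i p (C1a j k)) (fun i p => is_cpC1 i p C1al)
  (fun i p => is_cpC1 i p C1be) (fun i p => is_cpC1 i p (C1li ord0))
  (fun i p => is_cpC1 i p (C1vi ord0)) (fun i p => is_cpC1 i p (C1wi ord0))
  (fun j i p => is_cpC1 i p (C1li (xi j))) (fun j i p => is_cpC1 i p (C1Psi (xi j)))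
  (fun j i p => is_cpC1 i p (C1vi (xi j))) (fun j i p => is_cpC1 i p (C1wi (xi j)))
  (fun j k => congr1 (@complexf R m) (hasym j k))
  (fun p => is_cpC1 ord0 p C1v) (fun k p => is_cpC1 (xi k) p C1v)
  (fun p => is_cpC1 ord0 p C1w) (fun k p => is_cpC1 (xi k) p C1w)
  (fun k p => is_cpC1 (xi k) p C1Ps)
  (fun k => cpartial_swap (xi k) ord0 hv) (fun j k => cpartial_swap (xi j) (xi k) hv)
  (fun k => w_swap (xi k) ord0) (fun j k => w_swap (xi j) (xi k))
  (fI1E p) (conj_fI1E p).
rewrite mulrDr (mulrA (theta%:Cf p)) (mulrA (theta%:Cf p)) theta_opP conj_theta_opP H.
by rewrite -rhs_without_BE.
Qed.

Ltac solve_C1 := repeat match goal with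
  | |- C1C (@bigop.body _ _ _ _ _) => apply: C1C_sum => ?
  | |- C1C (@GRing.mul _ _ _) => apply: C1CM
  | |- C1C (@Algebra.add _ _ _) => apply: C1CD
  | |- C1C (@Algebra.opp _ _) => apply: C1CN
  | |- C1C (@GRing.scale _ _ _ _) => apply: C1CZ
  | |- C1C (cdt _) => rewrite /cdt
  | |- C1C (cdx _ _) => rewrite /cdx
  | |- C1C (cpartial _ (complexf l)) => exact: C1li
  | |- C1C (cpartial _ (complexf Psi)) => exact: C1Psi
  | |- C1C (cpartial _ (conjf _)) => exact: C1wi
  | |- C1C (cpartial _ _) => exact: C1vi
  | |- C1C (conjf _) => exact: C1w
  | |- C1C (complexf (a _ _)) => exact: C1a
  | |- C1C (complexf alpha) => exact: C1al
  | |- C1C (complexf beta) => exact: C1be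
  | |- C1C (complexf Psi) => exact: C1Ps
  | |- C1C v => exact: C1v end.

Lemma C1M0 : C1C M0.
Proof. rewrite /fluxM0 (expr2 al) (expr2 be); solve_C1. Qed.

Lemma C1V0 k : C1C (V0 k).
Proof. rewrite /fluxV0; solve_C1. Qed.

Lemma is_cpartial_sq i p : is_cpartial i sq p (cpartial i v p * w p + v p * cpartial i w p).
Proof. by apply: is_cpartialM; [exact: is_cpC1 C1v|exact: is_cpC1 C1w]. Qed.

Let real_complex_comb (x1 x2 x3 x4 x5 x6 x7 x8 : R) :
  (x1 + x2 - x3 - 2 * (x4 + x5) + x6 + 2 * (x7 + x8))%:C%C =
  x1%:C%C + x2%:C%C - x3%:C%C - 2 * (x4%:C%C + x5%:C%C) + x6%:C%C
  + 2 * (x7%:C%C + x8%:C%C).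
Proof.
have E2 x : (2 * x)%:C%C = 2 * x%:C%C :> R[i] by exact: (real_complexMn 2).
rewrite -(rmorphD (real_complex R) x4) -(rmorphD (real_complex R) x7) -!E2.
by rewrite -!(rmorphN (real_complex R)) -!(rmorphD (real_complex R)).
Qed.

Let real_sum2 (F : 'I_m -> 'I_m -> XR) p :
  ((\sum_j \sum_k F j k) p)%:C%C = sum2 (fun j k => (F j k)%:Cf p).
Proof. by rewrite -(fct_sum2E (fun j k => (F j k)%:Cf)) -complexf_sum2. Qed.

Let B_comb (x1 x2 x3 x4 x5 x6 x7 x8 : R[i]) :
  x1 + x2 - x3 - 2 * (x4 + x5) + x6 + 2 * (x7 + x8) =
  (x1 + x2 - 2 * (x4 + x5) + x6) - x3 + 2 * (x7 + x8).
Proof. by ring. Qed.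

Lemma fB_complexE p : (fB alpha beta a Psi l p)%:C%C =
  regular_B p - cpartial ord0 (alpha * A)%:Cf p
  + 2 * (sum2 (fun j k => cpartial (xi k) (a j k * dx j l * A)%:Cf p) + A%:Cf p * Ps p).
Proof.
rewrite /fB; move: (fA a Psi l) => B.
have Pt (g f : XR) n : (dt (g ^+ n * dt f) p)%:C%C =
    cpartial ord0 (g%:Cf ^+ n * cpartial ord0 f%:Cf) p.
  rewrite -[LHS]/((dt (g ^+ n * dt f))%:Cf p) (complexf_dt (_ * _)).
  by rewrite (complexfM (g ^+ n)) (complexfX n g) (complexf_dt f).
have P3 : (dt (alpha * B) p)%:C%C = cpartial ord0 (alpha * B)%:Cf p.
  by rewrite -[LHS]/((dt (alpha * B))%:Cf p) (complexf_dt (alpha * B)).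
have P4 : ((\sum_(j < m) \sum_(k < m) dx k (alpha * a j k * dx j l * dt l)) p)%:C%C =
    sum2 (fun j k => cpartial (xi k) (al * ca j k * lx j * lt) p).
  rewrite real_sum2; apply: eq_sum2 => j k.
  rewrite (complexf_dx k (_ * _)) (complexfM (alpha * a j k * _)).
  rewrite (complexfM (alpha * a j k)) (complexfM alpha).
  by rewrite (complexf_dx j l) (complexf_dt l).
have P5 : ((alpha * Psi * dt l) p)%:C%C = al p * Ps p * lt p.
  rewrite -[LHS]/((alpha * Psi * dt l)%:Cf p) (complexfM (alpha * Psi)) (complexfM alpha).
  by rewrite (complexf_dt l).
have P6 : ((\sum_(j < m) \sum_(k < m) dx j (a j k * dx k Psi)) p)%:C%C =
    sum2 (fun j k => cpartial (xi j) (ca j k * Psx k) p).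
  rewrite real_sum2; apply: eq_sum2 => j k.
  by rewrite (complexf_dx j (_ * _)) (complexfM (a j k)) (complexf_dx k Psi).
have P7 : ((\sum_(j < m) \sum_(k < m) dx k (a j k * dx j l * B)) p)%:C%C =
    sum2 (fun j k => cpartial (xi k) (a j k * dx j l * B)%:Cf p).
  by rewrite real_sum2; apply: eq_sum2 => j k; rewrite (complexf_dx k (_ * B)).
have P8 : ((B * Psi) p)%:C%C = B%:Cf p * Ps p.
  by rewrite -[LHS]/((B * Psi)%:Cf p) (complexfM B).
have H := real_complex_comb (dt (alpha ^+ 2 * dt l) p) (dt (beta ^+ 2 * dt l) p)
  (dt (alpha * B) p) ((\sum_(j < m) \sum_(k < m) dx k (alpha * a j k * dx j l * dt l)) p)
  ((alpha * Psi * dt l) p) ((\sum_(j < m) \sum_(k < m) dx j (a j k * dx k Psi)) p)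
  ((\sum_(j < m) \sum_(k < m) dx k (a j k * dx j l * B)) p) ((B * Psi) p).
apply: etrans H _; apply: (etrans _ (B_comb _ _ _ _ _ _ _ _)).
by congr (_ + _ - _ - 2 * (_ + _) + _ + 2 * (_ + _));
  [exact: (Pt alpha l 2%N)|exact: (Pt beta l 2%N)|exact: P3|exact: P4
  |exact: P5|exact: P6|exact: P7|exact: P8].
Qed.

(** The product rule is applied to [alpha A |v|^2] and [2 a l_j A |v|^2]. A derivative falling on
    the factor with [A] gives a term of [B]; one falling on [|v|^2] cancels the matching remainder
    in [regular_identity]. *)
Lemma classical_identity p : (forall i, partially_derivable A p i) ->
  (theta%:Cf
       * (opP alpha beta a z * conjf (fI1 alpha beta a Psi l v)
          + conjf (opP alpha beta a z) * fI1 alpha beta a Psi l v)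
     + cdt (fM alpha beta a Psi l v)
     + \sum_(k < m) cdx k (fV alpha beta a Psi l v k)) p
    = (rhs_without_B alpha beta a Psi l v
       + (fB alpha beta a Psi l)%:Cf * sqnormf v) p.
Proof.
move=> dA.
have isA i : is_cpartial i A%:Cf p (cpartial i A%:Cf p).
  by split; [exact: DeriveDef (dA i) erefl|rewrite cpartial_complexf; exact: is_derive_cst].
have Mp : cdt (fM alpha beta a Psi l v) p = cpartial ord0 M0 p
    - (cpartial ord0 (alpha * A)%:Cf p * (v p * w p)
       + al p * A%:Cf p * (vt p * w p + v p * wt p)).
  rewrite fME /cdt; apply/is_cpartial_val/is_cpartialB; first exact: is_cpC1 C1M0.
  rewrite (complexfM alpha) -[v p * w p]/(sq p) -[al p * A%:Cf p]/((al * A%:Cf) p).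
  apply: is_cpartialM; last exact: is_cpartial_sq.
  have H := is_cpartialM (is_cpC1 ord0 p C1al) (isA ord0).
  by rewrite (is_cpartial_val H).
have Vp : \sum_(k < m) cdx k (fV alpha beta a Psi l v k) p =
    \sum_k cpartial (xi k) (V0 k) p
    + 2 * sum2 (fun j k => cpartial (xi k) (a j k * dx j l * A)%:Cf p) * (v p * w p)
    + 2 * A%:Cf p * (advect ca lx vx p * w p + advect ca lx wx p * v p).
  transitivity (\sum_k (cpartial (xi k) (V0 k) p + \sum_j
      2 * (cpartial (xi k) (a j k * dx j l * A)%:Cf p * (v p * w p)
       + ca j k p * lx j p * A%:Cf p * (vx k p * w p + v p * wx k p)))).
    apply: eq_bigr => k _; rewrite fVE /cdx.
    apply/is_cpartial_val/is_cpartialD; first exact: is_cpC1 (C1V0 k).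
    apply: is_cpartial_sum => j; apply: is_cpartialZ.
    rewrite -[v p * w p]/(sq p) -[ca j k p * lx j p * A%:Cf p]/((ca j k * lx j * A%:Cf) p).
    rewrite (complexfM (a j k * dx j l)) (complexfM (a j k)) complexf_dx.
    apply: is_cpartialM; last exact: is_cpartial_sq.
    have H := is_cpartialM (is_cpC1 (xi k) p (C1CM (C1a j k) (C1li (xi j)))) (isA (xi k)).
    by rewrite (is_cpartial_val H).
  rewrite big_split -addrA; congr (_ + _); rewrite sum2E /advect.
  rewrite !(sum2Z, sum2Zr, sum2D); apply: eq_sum2_sym => j k.
  move: (cpartial _ _ _) (cpartial _ _ _) (A%:Cf p) (v p) (w p) (vx k p) (wx k p).
  move: (vx j p) (wx j p) (ca j k p) (ca k j p) (lx j p) (lx k p).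
  by move=> *; ring.
rewrite -[RHS]/(_ + (fB alpha beta a Psi l p)%:C%C * sqnormf v p) sqnormfE fB_complexE.
rewrite -[LHS]/(theta%:Cf p * (opP alpha beta a z p * conjc (fI1 alpha beta a Psi l v p)
     + conjc (opP alpha beta a z p) * fI1 alpha beta a Psi l v p)
  + cdt (fM alpha beta a Psi l v) p +
  (\sum_(k < m) cdx k (fV alpha beta a Psi l v k)) p) fct_sumE Mp Vp.
have := regular_identity p.
set t1 := theta%:Cf p * _; set t2 := cpartial ord0 M0 p; set t3 := \sum_k _.
move=> /(canRL (addrK _))/(canRL (addrK _)) ->.
rewrite -[sq p]/(v p * w p).
move: (advect _ _ _ _) (advect _ _ _ _) (sum2 _) (cpartial ord0 (alpha * _)%:Cf p) => *.
move: (A%:Cf p) (al p) (Ps p) (v p) (w p) (vt p) (wt p) (regular_B p).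
move: (rhs_without_B _ _ _ _ _ _ _) t2 t3 => *; ring.
Qed.

(** * Continuity of the integrands *)

Let contA : continuousC A%:Cf.
Proof.
rewrite (_ : A%:Cf = \sum_j \sum_k ca j k * lx j * lx k
  - \sum_j \sum_k cpartial (xi k) (ca j k * lx j) - Ps); last first.
  apply/funext => p; rewrite -[LHS]/((A p)%:C%C) fA_complexE.
  by rewrite -[RHS]/((\sum_j \sum_k _) p - (\sum_j \sum_k _) p - Ps p) !fct_sum2E.
apply: continuousCB; last by have [] := C1Ps.
apply: continuousCB; apply: continuousC_sum => j; apply: continuousC_sum => k.
  have [//] : C1C (ca j k * lx j * lx k) by solve_C1.
by have [_ _] : C1C (ca j k * lx j) by solve_C1.
Qed.

Let contC1 (f : X) : C1C f -> continuousC f. Proof. by case. Qed.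
Let contC1p i (f : X) : C1C f -> continuousC (cpartial i f). Proof. by case. Qed.

Let contI1 : continuousC (fI1 alpha beta a Psi l v).
Proof.
rewrite /fI1 (complexfM alpha) (complexf_dt l).
apply: continuousCD; last exact: continuousCM contA (contC1 C1v).
apply: continuousCD; first by apply: contC1; solve_C1.
apply: continuousC_sum => j; apply: continuousC_sum => k.
by apply: contC1p; solve_C1.
Qed.

Let contopP : continuousC (opP alpha beta a z).
Proof.
apply: continuousCD.
  apply: continuousCM; last exact: contC1 (C1zi ord0).
  by apply: contC1; solve_C1.
apply: continuousC_sum => j; apply: continuousC_sum => k.
exact: contC1p (C1CM (C1a j k) (C1zi (xi j))).
Qed.

Local Notation theta_PI1 := (theta%:Cf
       * (opP alpha beta a z * conjf (fI1 alpha beta a Psi l v)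
          + conjf (opP alpha beta a z) * fI1 alpha beta a Psi l v)).

Let cont_theta_PI1 : continuousC theta_PI1.
Proof.
apply: continuousCM; first exact: contC1 C1theta.
by apply: continuousCD; apply: continuousCM => //; exact: continuousC_conjf.
Qed.

(** [B1], [B2] and [B3] are the classical terms of [dist_B], grouped as it groups them. *)
Let B1 : X := cpartial ord0 (al ^+ 2 * lt) + cpartial ord0 (be ^+ 2 * lt).
Let B2 : X := 2 *: (\sum_j \sum_k cpartial (xi k) (al * ca j k * lx j * lt)
  + al * Ps * lt).
Let B3 : X := \sum_j \sum_k cpartial (xi j) (ca j k * Psx k).

Let B1E : (dt (alpha ^+ 2 * dt l) + dt (beta ^+ 2 * dt l))%:Cf = B1.
Proof.
rewrite (complexfD (dt _)) (complexf_dt (alpha ^+ 2 * dt l)) (complexf_dt (beta ^+ 2 * dt l)).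
rewrite (complexfM (alpha ^+ 2)) (complexfM (beta ^+ 2)).
by rewrite (complexfX 2 alpha) (complexfX 2 beta) (complexf_dt l).
Qed.

Let B2E : (2 *: (\sum_(j < m) \sum_(k < m) dx k (alpha * a j k * dx j l * dt l)
                   + alpha * Psi * dt l))%:Cf = B2.
Proof.
rewrite (complexfZ 2 (_ + _)) (complexfD (\sum_(j < m) _)) complexf_sum2.
rewrite (complexfM (alpha * Psi)) (complexfM alpha) (complexf_dt l) /B2.
congr (_ *: (_ + _)); apply: eq_bigr => j _; apply: eq_bigr => k _.
rewrite (complexf_dx k (_ * _)) (complexfM (alpha * a j k * _)).
rewrite (complexfM (alpha * a j k)) (complexfM alpha).
by rewrite (complexf_dx j l) (complexf_dt l).
Qed.

Let B3E : (\sum_(j < m) \sum_(k < m) dx j (a j k * dx k Psi))%:Cf = B3.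
Proof.
rewrite complexf_sum2; apply: eq_bigr => j _; apply: eq_bigr => k _.
by rewrite (complexf_dx j (_ * _)) (complexfM (a j k)) (complexf_dx k Psi).
Qed.

Let regular_BE p : regular_B p = B1 p - B2 p + B3 p.
Proof.
transitivity (cpartial ord0 (al ^+ 2 * lt) p + cpartial ord0 (be ^+ 2 * lt) p
    - 2 * ((\sum_j \sum_k cpartial (xi k) (al * ca j k * lx j * lt)) p
           + al p * Ps p * lt p)
    + (\sum_j \sum_k cpartial (xi j) (ca j k * Psx k)) p); last by [].
by rewrite /regular_B; congr (_ - 2 * (_ + _) + _); exact: esym (fct_sum2E _ _).
Qed.

Let contB1 : continuousC B1.
Proof.
by rewrite /B1 (expr2 al) (expr2 be); apply: continuousCD; apply: contC1p; solve_C1.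
Qed.

Let contB2 : continuousC B2.
Proof.
apply: continuousCZ; apply: continuousCD; last by apply: contC1; solve_C1.
by apply: continuousC_sum => j; apply: continuousC_sum => k; apply: contC1p; solve_C1.
Qed.

Let contB3 : continuousC B3.
Proof.
by apply: continuousC_sum => j; apply: continuousC_sum => k; apply: contC1p; solve_C1.
Qed.

Let contsq : continuousC sq. Proof. by apply: contC1; solve_C1. Qed.

Let advf (g : 'I_m -> X) : X := \sum_j \sum_k ca j k * lx j * g k.
Let advfE g p : advect ca lx g p = advf g p.
Proof. by rewrite /advf fct_sum2E. Qed.

(** [regular_identity] is solved for this function: all its other terms are already known to be
    continuous. *)
Let contrhs : continuousC (rhs_without_B alpha beta a Psi l v).
Proof.
rewrite (_ : rhs_without_B alpha beta a Psi l v =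
  theta_PI1 + cpartial ord0 M0 + \sum_k cpartial (xi k) (V0 k)
  - ((B1 - B2 + B3) * sq + al * A%:Cf * (vt * w + v * wt)
     - 2 *: (A%:Cf * (advf vx * w + advf wx * v)) + 2 *: (A%:Cf * Ps * sq))); last first.
  apply/funext => p.
  rewrite -[RHS]/(theta%:Cf p * (opP alpha beta a z p * conjc (fI1 alpha beta a Psi l v p)
     + conjc (opP alpha beta a z p) * fI1 alpha beta a Psi l v p)
    + cpartial ord0 M0 p + (\sum_k cpartial (xi k) (V0 k)) p
    - ((B1 p - B2 p + B3 p) * (v p * w p) + al p * A%:Cf p * (vt p * w p + v p * wt p)
      - 2 * (A%:Cf p * (advf vx p * w p + advf wx p * v p))
      + 2 * (A%:Cf p * Ps p * (v p * w p)))).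
  rewrite fct_sumE -regular_BE -!advfE regular_identity.
  move: (rhs_without_B _ _ _ _ _ _ p) (regular_B p) (A%:Cf p) (advect _ _ _ _) (advect _ _ _ _).
  move: (al p) (Ps p) (v p) (w p) (vt p) (wt p) => *; ring.
have cadv g : (forall k, C1C (g k)) -> continuousC (advf g).
  move=> hg; apply: continuousC_sum => j; apply: continuousC_sum => k.
  exact: contC1 (C1CM (C1CM (C1a j k) (C1li (xi j))) (hg k)).
apply: continuousCB.
  apply: continuousCD; first exact: continuousCD cont_theta_PI1 (contC1p ord0 C1M0).
  by apply: continuousC_sum => k; exact: contC1p (C1V0 k).
apply: continuousCD; last first.
  exact/continuousCZ/(continuousCM (continuousCM contA (contC1 C1Ps)) contsq).
apply: continuousCB.
  apply: continuousCD.
    exact: continuousCM (continuousCD (continuousCB contB1 contB2) contB3) contsq.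
  apply: continuousCM; first exact: continuousCM (contC1 C1al) contA.
  by apply: contC1; solve_C1.
apply: continuousCZ; apply: continuousCM contA _; apply: continuousCD.
  by apply: continuousCM (contC1 C1w); apply: cadv => k; exact: C1vi.
by apply: continuousCM (contC1 C1v); apply: cadv => k; exact: C1wi.
Qed.

Local Notation qA j k := ((a j k * dx j l * A)%:Cf).

Let qAE j k : qA j k = ca j k * lx j * A%:Cf.
Proof. by rewrite (complexfM (a j k * dx j l)) (complexfM (a j k)) (complexf_dx j l). Qed.

Let contqA j k : continuousC (qA j k).
Proof. by rewrite qAE; apply: continuousCM => //; apply: contC1; solve_C1. Qed.

Section distribution.
Variable phi : X.
Hypothesis hphi : test_function phi.
Local Notation phii i := (cpartial i phi).

Let C1phi : C1C phi. Proof. by apply/C1CE; exact: hphi.1. Qed.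

(* Integrands of the two sides; the derivatives of [M0 * phi] and [V0 k * phi],
   whose integrals vanish, are added to the left one. *)
Let lhs_integrand : X := theta_PI1 * phi - fM alpha beta a Psi l v * phii ord0
  + \sum_k - (fV alpha beta a Psi l v k * phii (xi k))
  + (cpartial ord0 (M0 * phi) + \sum_k cpartial (xi k) (V0 k * phi)).

Let rhs_integrand : X := rhs_without_B alpha beta a Psi l v * phi
  + (B1 * (sq * phi) - (- ((alpha * A)%:Cf * cpartial ord0 (sq * phi)))
     - B2 * (sq * phi) + B3 * (sq * phi)
     + 2 *: (\sum_j \sum_k - (qA j k * cpartial (xi k) (sq * phi))
             + (A * Psi)%:Cf * (sq * phi))).

(** The product rule for [V0 k * phi] cancels the [V0] part of the flux tested against the
    derivatives of [phi]; the divergence of [V0] and the part carrying [A] remain. *)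
Let sum_fV p : (\sum_k - (fV alpha beta a Psi l v k * phii (xi k))) p
   + (\sum_k cpartial (xi k) (V0 k * phi)) p =
  (\sum_k cpartial (xi k) (V0 k) p) * phi p
  - 2 * (v p * w p) * sum2 (fun j k => qA j k p * phii (xi k) p).
Proof.
have -> : sum2 (fun j k => qA j k p * phii (xi k) p) =
    \sum_k \sum_j qA j k p * phii (xi k) p by rewrite /sum2 exchange_big.
rewrite !fct_sumE -big_split mulr_suml mulr_sumr -sumrB; apply: eq_bigr => k _.
have VE : cpartial (xi k) (V0 k * phi) p =
    cpartial (xi k) (V0 k) p * phi p + V0 k p * phii (xi k) p.
  exact: is_cpartial_val (is_cpartialM (is_cpC1 _ p (C1V0 k)) (is_cpC1 _ p C1phi)).
have fVp : fV alpha beta a Psi l v k p = V0 k p + 2 * (v p * w p) * \sum_j qA j k p.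
  rewrite fVE -[LHS]/(V0 k p + (\sum_j _) p) fct_sumE mulr_sumr; congr (_ + _).
  apply: eq_bigr => j _; rewrite -[LHS]/(2 * (qA j k p * (v p * w p))).
  by move: (qA j k p) (v p) (w p) => *; ring.
rewrite -mulr_suml VE.
rewrite -[LHS]/(- (fV alpha beta a Psi l v k p * phii (xi k) p) +
  (cpartial (xi k) (V0 k) p * phi p + V0 k p * phii (xi k) p)) fVp.
move: (cpartial (xi k) (V0 k) p) (V0 k p) (phi p) (phii (xi k) p) (\sum_j _) (v p) (w p).
by move=> *; ring.
Qed.

(** In the derivative of [|v|^2 phi], the part falling on [|v|^2] gives the advection terms of
    [regular_identity], the part falling on [phi] gives the [A] terms of the flux. *)
Let sum_qA p : sum2 (fun j k => - (qA j k * cpartial (xi k) (sq * phi)) p) =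
  - (A%:Cf p * (advect ca lx vx p * w p + advect ca lx wx p * v p) * phi p)
  - (v p * w p) * sum2 (fun j k => qA j k p * phii (xi k) p).
Proof.
rewrite /advect !(sum2Z, sum2Zr, sum2N, sum2D); apply: eq_sum2 => j k.
have E : cpartial (xi k) (sq * phi) p =
    (vx k p * w p + v p * wx k p) * phi p + (v p * w p) * phii (xi k) p.
  exact: is_cpartial_val (is_cpartialM (is_cpartial_sq _ p) (is_cpC1 _ p C1phi)).
rewrite -[LHS]/(- (qA j k p * cpartial (xi k) (sq * phi) p)) E qAE.
rewrite -[(_ * _ * A%:Cf) p]/(ca j k p * lx j p * A%:Cf p).
move: (ca j k p) (lx j p) (A%:Cf p) (vx k p) (wx k p) (v p) (w p) (phi p) => *.
by move: (phii _ _) => *; ring.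
Qed.

(** Equality holds before integration: [regular_identity] times [phi] at each point, with the
    product rule for the terms tested against derivatives. *)
Let distribution_pointwise : lhs_integrand = rhs_integrand.
Proof.
apply/funext => p.
have Et : cpartial ord0 (sq * phi) p =
    (vt p * w p + v p * wt p) * phi p + (v p * w p) * phii ord0 p.
  exact: is_cpartial_val (is_cpartialM (is_cpartial_sq _ p) (is_cpC1 _ p C1phi)).
have EM : cpartial ord0 (M0 * phi) p = cpartial ord0 M0 p * phi p + M0 p * phii ord0 p.
  exact: is_cpartial_val (is_cpartialM (is_cpC1 _ p C1M0) (is_cpC1 _ p C1phi)).
have fMp : fM alpha beta a Psi l v p = M0 p - al p * A%:Cf p * (v p * w p).
  by rewrite fME (complexfM alpha).
have := regular_identity p.
move=> /(canRL (addrK _))/(canRL (addrK _)) E0'.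
have {E0'}E0 : theta_PI1 p = _ := E0'.
rewrite -[LHS]/(theta_PI1 p * phi p - fM alpha beta a Psi l v p * phii ord0 p
  + (\sum_k - (fV alpha beta a Psi l v k * phii (xi k))) p
  + (cpartial ord0 (M0 * phi) p + (\sum_k cpartial (xi k) (V0 k * phi)) p)).
rewrite -[RHS]/(rhs_without_B alpha beta a Psi l v p * phi p
  + (B1 p * (v p * w p * phi p)
     - (- ((alpha * A)%:Cf p * cpartial ord0 (sq * phi) p))
     - B2 p * (v p * w p * phi p) + B3 p * (v p * w p * phi p)
     + 2 * ((\sum_j \sum_k - (qA j k * cpartial (xi k) (sq * phi))) p
             + (A * Psi)%:Cf p * (v p * w p * phi p)))).
rewrite (fct_sum2E (fun j k => - (qA j k * cpartial (xi k) (sq * phi)))) sum_qA.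
have := sum_fV p; set S1 := (\sum_k - _) p; set S2 := (\sum_k cpartial _ _) p.
set S3 := \sum_k cpartial _ (V0 k) p; set S4 := sum2 _ => /(canRL (addrK _)) ->.
rewrite -/S4 EM Et fMp E0 regular_BE (complexfM alpha) (complexfM A Psi).
rewrite -[(al * A%:Cf) p]/(al p * A%:Cf p) -[(A%:Cf * Ps) p]/(A%:Cf p * Ps p) -/S3.
move: S2 S3 S4 (advect _ _ _ _) (advect _ _ _ _) (cpartial ord0 M0 p) => *.
move: (M0 p) (rhs_without_B _ _ _ _ _ _ p) (B1 p) (B2 p) (B3 p) => *.
move: (A%:Cf p) (al p) (Ps p) (v p) (w p) (vt p) (wt p) (phi p) (phii _ _) => *.
by ring.
Qed.

Let contfM : continuousC (fM alpha beta a Psi l v).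
Proof.
rewrite fME (complexfM alpha); apply: continuousCB; first exact: contC1 C1M0.
exact: continuousCM (continuousCM (contC1 C1al) contA) contsq.
Qed.

Let contfV k : continuousC (fV alpha beta a Psi l v k).
Proof.
rewrite fVE; apply: continuousCD; first exact: contC1 (C1V0 k).
by apply: continuousC_sum => j; exact: continuousCZ (continuousCM (contqA j k) contsq).
Qed.

Let contalA : continuousC (alpha * A)%:Cf.
Proof. rewrite (complexfM alpha); exact: continuousCM (contC1 C1al) contA. Qed.

Let contAPsi : continuousC (A * Psi)%:Cf.
Proof. rewrite (complexfM A Psi); exact: continuousCM contA (contC1 C1Ps). Qed.

Lemma distributional_identity :
    (dist_of theta_PI1
     + dist_dt (dist_of (fM alpha beta a Psi l v))
     + \sum_(k < m) dist_dx k (dist_of (fV alpha beta a Psi l v k))) phi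
    = (dist_of (rhs_without_B alpha beta a Psi l v)
       + dist_mul (sqnormf v) (dist_B alpha beta a Psi l)) phi.
Proof.
have [L L0 phi0] := test_function_support hphi.
have cphi : ccontinuous L phi by split => //; exact: contC1 C1phi.
have cphii i : ccontinuous L (phii i) by exact: cpartial_ccontinuous C1phi phi0.
have sqphi0 p : L < `|p| -> (sq * phi) p = 0.
  by move=> Lp; rewrite -[LHS]/(sq p * phi p) phi0// mulr0.
have C1sqphi : C1C (sq * phi) by exact: C1CM (C1CM C1v C1w) C1phi.
have csq : ccontinuous L (sq * phi) by split => //; exact: contC1 C1sqphi.
have csqi i : ccontinuous L (cpartial i (sq * phi)).
  exact: cpartial_ccontinuous C1sqphi sqphi0.
(* [I1] and [I2] integrate the two integrands term by term over a common radius [L]; the exact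
   derivatives contribute 0 to [I1]. *)
have I1 := has_cintegralD L0 (has_cintegralD L0 (has_cintegralB L0
    (has_cintegralM cont_theta_PI1 cphi) (has_cintegralM contfM (cphii ord0)))
  (has_cintegral_sum L0 (fun k => has_cintegralN L0 (has_cintegralM (contfV k) (cphii (xi k))))))
  (has_cintegralD L0 (has_cintegral_cpartial L0 ord0 C1M0 C1phi phi0)
    (has_cintegral_sum L0 (fun k => has_cintegral_cpartial L0 (xi k) (C1V0 k) C1phi phi0))).
have I2 := has_cintegralD L0 (has_cintegralM contrhs cphi)
  (has_cintegralD L0
    (has_cintegralD L0 (has_cintegralB L0 (has_cintegralB L0
      (has_cintegralM contB1 csq)
      (has_cintegralN L0 (has_cintegralM contalA (csqi ord0))))
      (has_cintegralM contB2 csq)) (has_cintegralM contB3 csq))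
    (has_cintegralZ L0 2 (has_cintegralD L0
      (has_cintegral_sum L0 (fun j => has_cintegral_sum L0 (fun k =>
        has_cintegralN L0 (has_cintegralM (contqA j k) (csqi (xi k))))))
      (has_cintegralM contAPsi csq)))).
have -> : (dist_of theta_PI1 + dist_dt (dist_of (fM alpha beta a Psi l v))
     + \sum_(k < m) dist_dx k (dist_of (fV alpha beta a Psi l v k))) phi = cintegral lhs_integrand.
  apply: etrans _ (esym I1.2).
  rewrite -[LHS]/(cintegral (theta_PI1 * phi) - cintegral (fM alpha beta a Psi l v * phii ord0)
    + (\sum_(k < m) dist_dx k (dist_of (fV alpha beta a Psi l v k))) phi) fct_sumE.
  (* Discards the zero integrals of the added derivatives. *)
  by rewrite (big1_eq (index_enum _) predT) !addr0.
rewrite distribution_pointwise; apply: etrans I2.2 _.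
rewrite sqnormfE /dist_B B1E B2E B3E.
rewrite -[RHS]/(cintegral (rhs_without_B alpha beta a Psi l v * phi)
  + (cintegral (B1 * (sq * phi)) - - cintegral ((alpha * A)%:Cf * cpartial ord0 (sq * phi))
   - cintegral (B2 * (sq * phi)) + cintegral (B3 * (sq * phi))
   + 2 * ((\sum_(j < m) \sum_(k < m) dist_dx k (dist_of (qA j k))) (sq * phi)
          + cintegral ((A * Psi)%:Cf * (sq * phi))))).
rewrite fct_sumE; congr (_ + (_ + _ * (_ + _))).
by apply: eq_bigr => j _; rewrite fct_sumE.
Qed.

End distribution.

End weighted_operator.

Theorem theorem2p1 (R : realType) (m : nat)
    (alpha beta : 'rV[R]_m.+1 -> R)
    (a : 'I_m -> 'I_m -> 'rV[R]_m.+1 -> R)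
    (z v : 'rV[R]_m.+1 -> R[i])
    (Psi l theta : 'rV[R]_m.+1 -> R)
    (halpha : Ck 2 alpha) (hbeta : Ck 2 beta)
    (ha : forall j k, C12 (a j k))
    (hasym : forall j k, a j k = a k j)
    (hz : cCk 2 z) (hv : cCk 2 v)
    (hPsi : Ck 2 Psi) (hl : Ck 2 l)
    (htheta : theta = expR \o l)
    (hvz : v = theta%:Cf * z) :
  (* the identity in the sense of distributions on R^{1+m} *)
  (forall phi : 'rV[R]_m.+1 -> R[i], test_function phi ->
    (dist_of (theta%:Cf
        * (opP alpha beta a z * conjf (fI1 alpha beta a Psi l v)
           + conjf (opP alpha beta a z) * fI1 alpha beta a Psi l v))
     + dist_dt (dist_of (fM alpha beta a Psi l v))
     + \sum_(k < m) dist_dx k (dist_of (fV alpha beta a Psi l v k))) phi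
    = (dist_of (rhs_without_B alpha beta a Psi l v)
       + dist_mul (sqnormf v) (dist_B alpha beta a Psi l)) phi)
  /\
  (* the pointwise identity where the derivatives of A exist classically *)
  (forall p : 'rV[R]_m.+1,
    (forall i, partially_derivable (fA a Psi l) p i) ->
    (theta%:Cf
       * (opP alpha beta a z * conjf (fI1 alpha beta a Psi l v)
          + conjf (opP alpha beta a z) * fI1 alpha beta a Psi l v)
     + cdt (fM alpha beta a Psi l v)
     + \sum_(k < m) cdx k (fV alpha beta a Psi l v k)) p
    = (rhs_without_B alpha beta a Psi l v
       + (fB alpha beta a Psi l)%:Cf * sqnormf v) p).
Proof.
split=> [phi hphi|p dA]; first exact: distributional_identity.
exact: classical_identity.
Qed.
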